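(* Assume that $w:\mathbb R\to(-\infty,0]$ satisfies Assumption (A) given in the context, with $\operatorname{supp}w=[-s_w,s_w]$, and that $w$ is additionally $C^2$ on $(-s_w,s_w)$. Then for all sufficiently small $\ell>0$ and all $\gamma>\gamma_c$, where $\gamma_c=\gamma_c(\ell)$ is the transition point of $\mathcal F_{\gamma,\ell}$, a global minimiser of $\mathcal F_{\gamma,\ell}$ over $\mathcal P(\mathbb T)$ exists, and every global minimiser $\rho_{\gamma,\ell}$ is a nontrivial single-cluster state, i.e. $\rho_{\gamma,\ell}\neq\rho_{\rm unif}$ and there exists a translation $T:\mathbb T\to\mathbb T$ such that $\rho_{\gamma,\ell}=\rho_{\gamma,\ell}^\ast\circ T$.
   Context: $\mathbb T\simeq[0,1)$ is the one-dimensional torus, $\mathcal P(\mathbb T)$ the set of Borel probability measures on it (absolutely continuous measures are identified with their densities), and $\rho_{\rm unif}\equiv1$. Assumption (A) on $w:\mathbb R\to(-\infty,0]$: (i) $w$ is even, Lipschitz continuous, and non-decreasing on $[0,\infty)$; (ii) $w$ has compact support, there is $s_w\in[0,\infty)$ with $\operatorname{supp}w=[-s_w,s_w]$, and $w\le 0$; (iii) $w$ is $C^2$ in a neighbourhood of $0$ and attains its global minimum at $0$, with $w''(0)>0$. $W_{\gamma,\ell}(x):=\gamma\,\ell\,w(x/\ell)$ for $|x|<\tfrac12$, extended $1$-periodically. The free energy is $$\mathcal F_{\gamma,\ell}(\rho)=\int_{[0,1]}\rho\log\rho\,dx+\frac12\iint_{[0,1]^2}W_{\gamma,\ell}(x-y)\rho(x)\rho(y)\,dx\,dy$$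 (with value $+\infty$ if $\rho$ has no density or $\rho\log\rho$ is not integrable). Transition point: for fixed $\ell>0$, $\gamma_c>0$ is the transition point of $\mathcal F_{\gamma,\ell}$ if (1) for $0<\gamma<\gamma_c$, $\rho_{\rm unif}$ is the unique minimiser of $\mathcal F_{\gamma,\ell}$; (2) for $\gamma=\gamma_c$, $\rho_{\rm unif}$ is a minimiser; (3) for $\gamma>\gamma_c$ there exists a minimiser $\rho_\gamma\in\mathcal P(\mathbb T)\setminus\{\rho_{\rm unif}\}$. Symmetric decreasing rearrangement: for measurable $f:\mathbb T\to[0,\infty)$, $f^\ast:\mathbb T\to[0,\infty)$ is the (unique up to null sets) measurable function that depends only on the geodesic distance $d(\cdot,0)$ to $0\in\mathbb T$, is non-increasing in that distance, and satisfies $|\{f^\ast>t\}|=|\{f>t\}|$ for all $t>0$. *)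

(* Defs.v *)
From HB Require Import structures.
From mathcomp Require Import all_boot all_order all_algebra.
From mathcomp Require Import all_classical all_reals all_analysis.

Set Implicit Arguments.
Unset Strict Implicit.
Unset Printing Implicit Defensive.

Import Order.TTheory GRing.Theory Num.Theory.
Import numFieldNormedType.Exports.

Local Open Scope classical_set_scope.
Local Open Scope ring_scope.

Section Potential.
Context {R : realType}.
Implicit Types (w f : R -> R) (s g l : R).

(* Meant for open [U], where the pointwise conditions do say that [f] is of
   class C^2 on [U]. *)
Definition C2_on (U : set R) f : Prop :=
  forall x, U x ->
    [/\ derivable f x 1, derivable (f^`()%classic) x 1 &
        {for x, continuous (f^`(2)%classic)}].

Record assumptionA w s : Prop := AssumptionA {
  A_even : forall x, w (- x) = w x ;
  A_lipschitz : [lipschitz w x | x in [set: R]] ;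
  A_nondecreasing : {in `[0, +oo[ &, {homo w : x y / x <= y}} ;
  A_radius_ge0 : 0 <= s ;
  A_support : closure [set x | w x != 0] = `[- s, s]%classic ;
  A_nonpositive : forall x, w x <= 0 ;
  A_C2_near0 : exists2 U : set R, open_nbhs 0 U & C2_on U w ;
  A_min0 : forall x, w 0 <= w x ;
  A_convex0 : 0 < (w^`(2)%classic) 0 }.

(* The representative of [x] modulo 1 in [-1/2, 1/2). *)
Definition centered (x : R) : R := x - (Num.floor (x + 2^-1))%:~R.

(* The representative of [x] modulo 1 in [0, 1). *)
Definition torus_repr (x : R) : R := x - (Num.floor x)%:~R.

(* [g * l * w (x / l)] on [|x| < 1/2], extended 1-periodically; at 1/2 modulo 1,
   where that leaves the value open, it is the one at [x = - 1/2]. *)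
Definition potential w g l (x : R) : R := g * l * w (centered x / l).

End Potential.

Section Torus.
Context {R : realType}.
Implicit Types (w rho f fs : R -> R) (g l gc : R).

Local Notation leb := (@lebesgue_measure R).

(* The torus is represented by its fundamental domain [0, 1), and a Borel
   probability measure on the torus by one on the line that gives mass 1 to
   this domain. Functions on the torus are functions on the line of which only
   the values on the domain matter. *)
Definition torus : set R := `[0, 1[%classic.

Definition torus_dist (x y : R) : R := `|centered (x - y)|.

Definition translation (a x : R) : R := torus_repr (x + a).

Notation prob := (probability (measurableTypeR R) R).
Implicit Types mu nu : prob.

Definition prob_torus : set prob := [set mu | mu torus = 1%E].

(* Measures are functions on all sets, hence compared on Borel sets only. *)
Definition same_prob mu nu : Prop :=
  forall A : set (measurableTypeR R), measurable A -> mu A = nu A.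

Definition rho_unif : prob := uniform_prob (@ltr01 R).

Definition is_density mu rho : Prop :=
  [/\ measurable_fun torus rho,
      forall x, torus x -> 0 <= rho x &
      forall A : set (measurableTypeR R), measurable A ->
        mu A = (\int[leb]_(x in A `&` torus) (rho x)%:E)%E].

(* The density when there is one; unique up to null sets. *)
Definition density mu : R -> R := xget (cst 0) [set rho | is_density mu rho].

(* [0 log 0 = 0], since [ln 0 = 0]. *)
Definition xlogx (r : R) : R := r * ln r.

Definition entropy rho : \bar R := (\int[leb]_(x in torus) (xlogx (rho x))%:E)%E.

Definition interaction w g l rho : \bar R :=
  ((2^-1)%:E * \int[leb \x leb]_(z in torus `*` torus)
     (potential w g l (z.1 - z.2) * rho z.1 * rho z.2)%:E)%E.

Definition free_energy w g l mu : \bar R :=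
  if `[< (exists rho, is_density mu rho) /\
         leb.-integrable torus (fun x => (xlogx (density mu x))%:E) >]
  then (entropy (density mu) + interaction w g l (density mu))%E
  else +oo%E.

Definition minimiser w g l mu : Prop :=
  prob_torus mu /\
  forall nu, prob_torus nu -> (free_energy w g l mu <= free_energy w g l nu)%E.

Definition transition_point w l gc : Prop :=
  [/\ 0 < gc,
      forall g, 0 < g < gc ->
        minimiser w g l rho_unif /\
        forall mu, minimiser w g l mu -> same_prob mu rho_unif,
      minimiser w gc l rho_unif &
      forall g, gc < g ->
        exists2 mu, minimiser w g l mu & ~ same_prob mu rho_unif].

(* [fs] is (a version of) the symmetric decreasing rearrangement of [f].
   Applied to points at equal distance from 0, the third condition also says
   that [fs] depends on that distance only. *)
Definition symmetric_decreasing_rearrangement f fs : Prop :=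
  [/\ measurable_fun torus fs,
      forall x, torus x -> 0 <= fs x,
      forall x y, torus x -> torus y ->
        torus_dist x 0 <= torus_dist y 0 -> fs y <= fs x &
      forall t : R, 0 < t ->
        leb (torus `&` [set x | t < fs x]) = leb (torus `&` [set x | t < f x])].

Definition single_cluster mu : Prop :=
  exists rho rhos (a : R),
    [/\ is_density mu rho,
        symmetric_decreasing_rearrangement rho rhos &
        {ae leb, forall x, torus x -> rho x = rhos (translation a x)}].

End Torus.

(* Main.v *)
Require Import Defs.
From HB Require Import structures.
From mathcomp Require Import all_boot all_order all_algebra.
From mathcomp Require Import all_classical all_reals all_analysis.
From mathcomp Require Import measurable_realfun.
From mathcomp Require Import ring lra.

(** Existence of a minimiser beyond the transition point [gc] is part of the
    definition of [gc]. It remains to show that a minimiser [mu] at strength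
    [g > gc] is not uniform and that its density is, up to a translation,
    symmetric decreasing. Write [K] for minus the potential: an even, Lipschitz,
    periodic kernel that is nonincreasing in the distance to 0 and has a strict
    maximum at 0. On densities the free energy is the entropy minus half of
    [energy K f f], the integral of [f] against its convolution with [K].

    Nontriviality ([minimiser_not_unif]): at a strength between [gc] and [g]
    there is a minimiser that differs from the uniform state, hence has positive
    entropy; since it does not do worse than the uniform state, its interaction
    energy is strictly better, and raising the strength to [g] makes it strictly
    better overall.

    Regularity ([euler_lagrange]): a minimiser [f] is almost everywhere equal to
    the Gibbs density [r] proportional to [exp (K * f)]. The first variation of
    the free energy in the direction from [f] to [r] is minus the relative entropy
    of [f] with respect to [r], so minimality forces this relative entropy to
    vanish. Hence [r] is continuous, positive and periodic, and
    [ln r = K * r - const].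

    Symmetry: fix a reflection of the circle, let [D x] be the difference between
    the values of [r] at [x] and at the mirror image of [x], and consider the
    half circle on one side of the axis. Polarising [r], that is, moving the
    larger value of each mirror pair to that side, preserves the entropy and
    changes the energy by the energy between the odd extensions [N] and [P] of
    the negative and positive parts of [D]. This energy is nonnegative, so
    minimality makes it zero, and [K * P] vanishes wherever [D < 0]. By
    continuity [K * P] also vanishes at a limit point [x0] of [{D < 0}] in the
    half circle, whereas [K * N] is positive there, because the maximum of [K] is
    strict. As [ln r x0 - ln r (mirror x0)] is [K * P - K * N] at [x0], it follows
    that [D x0 < 0]. So [{D < 0}] is open and closed in the half circle, and
    therefore empty or everything ([reflection_dichotomy]). Taking reflections
    for which a maximum point [p] of [r] lies in the half circle rules out the
    second case: a point and its mirror image are then ordered according to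
    their distance to [p] for every such reflection, which says that [r] is
    symmetric decreasing about [p] ([symmetric_decreasing_about_max]).

    The dichotomy takes the place of the equality case of the Riesz rearrangement
    inequality. It is local enough to apply although [w] may be constant away
    from 0. *)

Set Implicit Arguments.
Unset Strict Implicit.
Unset Printing Implicit Defensive.

Import Order.TTheory GRing.Theory Num.Theory.
Import numFieldNormedType.Exports.

Local Open Scope classical_set_scope.
Local Open Scope ring_scope.

(** * Integration over the torus *)

(** The mean over the torus, locked because unification must never unfold
    integrals in order to compare two means. *)
HB.lock Definition avg {R : realType} (f : R -> R) : R :=
  \int[@lebesgue_measure R]_(x in @torus R) f x.

Section TorusIntegral.
Context {R : realType}.
Implicit Types (f h : R -> R) (c M : R).

Local Notation leb := (@lebesgue_measure R).
Local Notation torus := (@torus R).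

Definition L1 f : Prop := leb.-integrable torus (EFin \o f).

Lemma measurable_torus : measurable (torus : set (measurableTypeR R)).
Proof. exact: measurable_itv. Qed.

Lemma lebesgue_torus : leb torus = 1%E.
Proof. by rewrite /torus lebesgue_measure_itv/= lte_fin ltr01 oppr0 adde0. Qed.

Lemma L1_measurable f : L1 f -> measurable_fun torus f.
Proof. by move=> /measurable_int /measurable_EFinP. Qed.

Lemma L1_bounded f M : measurable_fun torus f ->
  (forall x, torus x -> `|f x| <= M) -> L1 f.
Proof.
move=> mf fM; apply: measurable_bounded_integrable => //.
- exact: measurable_torus.
- have : (leb torus < +oo)%E by rewrite lebesgue_torus ltry.
  exact.
- exists M; split; first exact: num_real.
  by move=> N MN x /fM /le_trans; apply; exact: ltW.
Qed.

Lemma L1_cst c : L1 (cst c).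
Proof. by apply: (@L1_bounded _ `|c|) => // x _ /=. Qed.

Lemma L1D f h : L1 f -> L1 h -> L1 (fun x => f x + h x).
Proof. by move=> Lf Lh; exact: (integrableD measurable_torus Lf Lh). Qed.

Lemma L1N f : L1 f -> L1 (fun x => - f x).
Proof. by move=> Lf; exact: (integrableN Lf). Qed.

Lemma L1B f h : L1 f -> L1 h -> L1 (fun x => f x - h x).
Proof. by move=> Lf Lh; apply: L1D => //; exact: L1N. Qed.

Lemma L1Z c f : L1 f -> L1 (fun x => c * f x).
Proof. by move=> Lf; exact: (integrableZl measurable_torus c Lf). Qed.

Lemma L1M_bounded f h M : L1 f -> measurable_fun torus h ->
  (forall x, torus x -> `|h x| <= M) -> L1 (fun x => f x * h x).
Proof.
move=> Lf mh hM.
apply: (integrableMl measurable_torus Lf mh).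
exists M; split; first exact: num_real.
by move=> N MN x /hM /le_trans; apply; exact: ltW.
Qed.

Lemma L1_le f h : measurable_fun torus f -> L1 h ->
  (forall x, torus x -> `|f x| <= `|h x|) -> L1 f.
Proof.
move=> mf Lh fh; apply: (le_integrable measurable_torus _ _ Lh).
  exact/measurable_EFinP.
by move=> x Tx /=; rewrite lee_fin fh.
Qed.

Lemma L1_norm f : L1 f -> L1 (fun x => `|f x|).
Proof. exact: integrable_norm. Qed.

Lemma eq_L1 f h : (forall x, torus x -> f x = h x) -> L1 f -> L1 h.
Proof.
move=> fh; apply: (eq_integrable measurable_torus (EFin \o f)).
by move=> x /set_mem Tx /=; rewrite fh.
Qed.

Lemma eq_avg f h : (forall x, torus x -> f x = h x) -> avg f = avg h.
Proof. by move=> fh; rewrite !avg.unlock; apply: eq_Rintegral => x /set_mem /fh. Qed.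

Lemma avgD f h : L1 f -> L1 h -> avg (fun x => f x + h x) = avg f + avg h.
Proof.
by move=> Lf Lh; rewrite !avg.unlock; exact: (RintegralD measurable_torus Lf Lh).
Qed.

Lemma avgZ c f : L1 f -> avg (fun x => c * f x) = c * avg f.
Proof. by move=> Lf; rewrite !avg.unlock; exact: (RintegralZl c measurable_torus Lf). Qed.

Lemma avgN f : L1 f -> avg (fun x => - f x) = - avg f.
Proof.
move=> Lf; rewrite -mulN1r -avgZ//.
by apply: eq_avg => x _; rewrite mulN1r.
Qed.

Lemma avgB f h : L1 f -> L1 h -> avg (fun x => f x - h x) = avg f - avg h.
Proof. by move=> Lf Lh; rewrite avgD ?avgN//; exact: L1N. Qed.

Lemma avg_cst c : avg (cst c) = c.
Proof.
rewrite avg.unlock (Rintegral_cst _ measurable_torus).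
rewrite -[RHS]mulr1; congr (_ * _); exact: (congr1 fine lebesgue_torus).
Qed.

Lemma avg_ge0 f : (forall x, torus x -> 0 <= f x) -> 0 <= avg f.
Proof. by move=> f0; rewrite avg.unlock; apply: Rintegral_ge0. Qed.

Lemma le_avg f h : L1 f -> L1 h ->
  (forall x, torus x -> f x <= h x) -> avg f <= avg h.
Proof.
move=> Lf Lh fh; rewrite !avg.unlock.
exact: (le_Rintegral measurable_torus Lf Lh fh).
Qed.

Lemma le_normr_avg f : L1 f -> `|avg f| <= avg (fun x => `|f x|).
Proof.
by move=> Lf; rewrite !avg.unlock; exact: (le_normr_Rintegral measurable_torus Lf).
Qed.

(** Passes between the extended real integral of the definitions and the real mean. *)
Lemma avg_EFin f : L1 f -> (\int[leb]_(x in torus) (f x)%:E)%E = (avg f)%:E.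
Proof.
move=> Lf; rewrite !avg.unlock /Rintegral fineK//.
exact: (integrable_fin_num measurable_torus Lf).
Qed.

Lemma ae_eq_avg f h : L1 f -> measurable_fun torus h ->
  ae_eq leb torus f h -> L1 h /\ avg h = avg f.
Proof.
move=> Lf mh fh.
have fhE : ae_eq leb torus (EFin \o h) (EFin \o f).
  by apply: ae_eq_comp; exact: ae_eq_sym.
have mhE : measurable_fun torus (EFin \o h) by exact/measurable_EFinP.
have Lh : L1 h.
  apply/integrableP; split => //.
  have /integrableP[mf] := Lf; apply: le_lt_trans.
  rewrite le_eqVlt; apply/orP; left; apply/eqP.
  apply: ae_eq_integral => //.
  - exact: measurable_torus.
  - exact: measurableT_comp.
  - exact: measurableT_comp.
  - exact: (@ae_eq_comp _ _ _ _ _ _ _ abse).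
split=> //; rewrite !avg.unlock /Rintegral; congr fine.
apply: ae_eq_integral => //; first exact: measurable_torus.
by have /integrableP[] := Lf.
Qed.

Lemma avg_le0_ae f : L1 f -> (forall x, torus x -> 0 <= f x) -> avg f <= 0 ->
  ae_eq leb torus f (cst 0).
Proof.
move=> Lf f0 If.
have mf : measurable_fun torus (EFin \o f).
  by apply/measurable_EFinP; exact: L1_measurable.
have : (\int[leb]_(x in torus) `|(EFin \o f) x| = 0)%E.
  transitivity (\int[leb]_(x in torus) (f x)%:E)%E.
    by apply: eq_integral => x /set_mem Tx /=; rewrite ger0_norm ?f0.
  by rewrite avg_EFin//; congr EFin; apply/le_anti; rewrite If avg_ge0.
move=> /(ae_eq_integral_abs _ measurable_torus mf).
by apply: filterS => x h Tx; have [] := h Tx.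
Qed.

End TorusIntegral.

(** * Geometry of the circle, and reflections *)

Section TorusGeometry.
Context {R : realType}.
Implicit Types (x y b : R) (f : R -> R) (g : R -> \bar R) (m : int).

Local Notation leb := (@lebesgue_measure R).
Local Notation torus := (@torus R).

Lemma periodic_int (U : Type) (f : R -> U) x m :
  (forall x, f (x + 1) = f x) -> f (x + m%:~R) = f x.
Proof.
move=> fP.
have fPn n y : f (y + n%:R) = f y.
  elim: n y => [|n IH] y; first by rewrite addr0.
  by rewrite -addn1 natrD addrA fP IH.
case: m => n; first exact: fPn.
by rewrite NegzE mulrNz -[LHS](fPn n.+1) subrK.
Qed.

Lemma torus_repr_shift x : exists m, torus_repr x = x + m%:~R.
Proof. by exists (- Num.floor x); rewrite /torus_repr mulrNz. Qed.

Lemma centered_shift x : exists m, centered x = x + m%:~R.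
Proof. by exists (- Num.floor (x + 2^-1)); rewrite /centered mulrNz. Qed.

Lemma torus_repr_in x : torus (torus_repr x).
Proof.
rewrite /torus /torus_repr /= in_itv /=.
by have := floor_itv x; rewrite intrD mulr1z => /andP[h1 h2]; apply/andP; split; lra.
Qed.

Lemma centered_bounds x : - 2^-1 <= centered x < 2^-1.
Proof.
rewrite /centered.
have := floor_itv (x + 2^-1); rewrite intrD mulr1z => /andP[h1 h2].
by apply/andP; split; lra.
Qed.

Lemma centered_id x : - 2^-1 <= x < 2^-1 -> centered x = x.
Proof.
move=> /andP[h1 h2]; rewrite /centered (@floor_def _ _ 0) ?subr0//=.
by rewrite add0r mulr1z mulr0z; apply/andP; split; lra.
Qed.

Lemma periodic_torus_repr (U : Type) (f : R -> U) x :
  (forall x, f (x + 1) = f x) -> f (torus_repr x) = f x.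
Proof. by move=> fP; have [m ->] := torus_repr_shift x; rewrite periodic_int. Qed.

Lemma periodic_centered (U : Type) (f : R -> U) x :
  (forall x, f (x + 1) = f x) -> f (centered x) = f x.
Proof. by move=> fP; have [m ->] := centered_shift x; rewrite periodic_int. Qed.

Lemma centeredD1 x : centered (x + 1) = centered x.
Proof.
rewrite /centered (_ : x + 1 + 2^-1 = x + 2^-1 + 1); last by lra.
by rewrite floorDrz ?rpred1// floor1 intrD mulr1z; lra.
Qed.

(** The distance to the nearest integer, i.e. the geodesic distance to 0 on the
    circle. *)
Definition cdist x : R := `|centered x|.

Lemma cdist_le_half x : cdist x <= 2^-1.
Proof. by have /andP[h1 h2] := centered_bounds x; rewrite /cdist ler_norml h1 ltW. Qed.

(** The centred representative is at most 1/2 in absolute value, whereas a different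
    one is at least 1 away from it. *)
Lemma cdist_min x m : cdist x <= `|x + m%:~R|.
Proof.
have [k ck] := centered_shift x.
have -> : x + m%:~R = centered x + (m - k)%:~R by rewrite ck intrD mulrNz; lra.
have [->|n0] := eqVneq (m - k) 0; first by rewrite mulr0z addr0.
have n1 : 1 <= `|(m - k)%:~R| :> R by rewrite -intr_norm ler1z -gtz0_ge1 normr_gt0.
have := cdist_le_half x; have := ler_normB (centered x + (m - k)%:~R) (centered x).
by rewrite addrAC subrr add0r /cdist; lra.
Qed.

Lemma cdist_lipschitz x y : cdist x <= cdist y + `|x - y|.
Proof.
have [k ck] := centered_shift y; apply: le_trans (cdist_min x k) _.
by rewrite /cdist ck -[x in x + _](subrK y) -addrA addrC; exact: ler_normD.
Qed.

Lemma cdistD1 x : cdist (x + 1) = cdist x.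
Proof. by rewrite /cdist centeredD1. Qed.

Lemma cdistN x : cdist (- x) = cdist x.
Proof.
have le y : cdist (- y) <= cdist y.
  have [k ck] := centered_shift y; apply: le_trans (cdist_min _ (- k)) _.
  by rewrite mulrNz -opprD normrN /cdist ck.
by apply/le_anti; rewrite le -[X in _ && (cdist X <= _)]opprK le.
Qed.

Lemma cdist_id x : `|x| <= 2^-1 -> cdist x = `|x|.
Proof.
rewrite ler_norml => /andP[h1]; rewrite le_eqVlt => /predU1P[->|h2].
  rewrite -cdistN /cdist centered_id ?normrN//.
  by apply/andP; split; lra.
by rewrite /cdist centered_id// h1.
Qed.

Lemma cdist1B x : cdist (1 - x) = cdist x.
Proof. by rewrite addrC cdistD1 cdistN. Qed.

(** Points on the same side of an axis are closer to each other than to each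
    other's mirror images. The axis is the one through 0 and 1/2. *)
Lemma cdist_reflect x y : 0 < x < 2^-1 -> 0 < y < 2^-1 ->
  cdist (x - y) <= cdist (x + y).
Proof.
move=> /andP[x0 x1] /andP[y0 y1].
have -> : cdist (x - y) = `|x - y|.
  by apply: cdist_id; rewrite ler_norml; apply/andP; split; lra.
have [h|h] := leP (x + y) 2^-1.
  have h' : `|x + y| = x + y by rewrite ger0_norm//; lra.
  by rewrite cdist_id h'// ler_norml; apply/andP; split; lra.
have h' : `|1 - (x + y)| = 1 - (x + y) by rewrite ger0_norm//; lra.
by rewrite -cdist1B cdist_id h' ?ler_norml; [apply/andP; split; lra|lra].
Qed.

Lemma measurable_reflect b : measurable_fun [set: R] (fun x => b - x).
Proof. exact: measurable_funB. Qed.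

Lemma lebesgue_reflect b (A : set (measurableTypeR R)) : measurable A ->
  leb A = pushforward leb (fun x : measurableTypeR R => b - x : measurableTypeR R) A.
Proof.
move: A; apply: lebesgue_measure_unique; first exact: measurable_reflect.
move=> mr X /ocitvP[->|[[u v] /= uv ->]]; first by rewrite !measure0.
rewrite [RHS]/(pushforward _ _ _).
rewrite /pushforward (_ : _ @^-1` _ = `[b - v, b - u[%classic).
  rewrite !lebesgue_measure_itv/= !lte_fin uv ltrD2l ltrN2 uv -!EFinB.
  by congr EFin; lra.
by apply/seteqP; split => x /=; rewrite !in_itv /= => /andP[h1 h2];
  apply/andP; split; lra.
Qed.

Lemma ge0_integral_reflect b (D : set R) g : measurable D ->
  measurable_fun [set: R] g -> (forall x, 0 <= g x)%E ->
  (\int[leb]_(x in (fun x => b - x)%R @^-1` D) g (b - x)%R = \int[leb]_(x in D) g x)%E.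
Proof.
move=> mD mg g0.
have /= <- := @ge0_integral_pushforward _ _ (measurableTypeR R) (measurableTypeR R)
  R _ (measurable_reflect b) leb D g mD.
- apply: eq_measure_integral => [|mr A mA _]; first exact: measurable_reflect.
  by rewrite [RHS](lebesgue_reflect b mA).
- exact: measurable_funTS.
- by move=> x _.
Qed.

(** For [b] in the fundamental domain, the reflection maps each of the two pieces
    [`[0, b]] and [`]b, 1[] to itself modulo 1. *)
Lemma ge0_integral_torus_reflect b g :
  measurable_fun [set: R] g -> (forall x, 0 <= g x)%E ->
  (forall x, g (x + 1) = g x) ->
  (\int[leb]_(x in torus) g (b - x)%R = \int[leb]_(x in torus) g x)%E.
Proof.
move=> mg g0 gP.
wlog : b / torus b.
  move=> H; rewrite -(H (torus_repr b)); last exact: torus_repr_in.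
  apply: eq_integral => x _; have [m ->] := torus_repr_shift b.
  by rewrite addrAC (periodic_int _ _ gP).
rewrite /torus /= in_itv /= => /andP[b0 b1].
have sub1 D : measurable_fun D (fun x => g (b - x)).
  by apply: measurable_funTS; apply: measurableT_comp => //; exact: measurable_reflect.
have mA : measurable (`[0, b]%classic : set (measurableTypeR R)) by exact: measurable_itv.
have mB : measurable (`]b, 1[%classic : set (measurableTypeR R)) by exact: measurable_itv.
have dAB : [disjoint `[0%R, b]%classic & `]b, 1%R[%classic].
  apply/disj_setPS => x [] /=; rewrite !in_itv /= => /andP[_ xb] /andP[bx _].
  by have := lt_le_trans bx xb; rewrite ltxx.
have -> : `[0, 1[%classic = `[0, b]%classic `|` `]b, 1[%classic.
  by apply: itv_bndbnd_setU; rewrite bnd_simp.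
rewrite !ge0_integral_setU//; [|exact: measurable_funTS|exact: sub1].
congr (_ + _)%E.
- rewrite -[RHS](ge0_integral_reflect b mA mg g0).
  congr (integral _ _ _); apply/seteqP; split => x /=; rewrite !in_itv /=;
    by move=> /andP[h1 h2]; apply/andP; split; lra.
- rewrite -[RHS](ge0_integral_reflect (b + 1) mB mg g0).
  transitivity (\int[leb]_(x in `]b, 1%R[) g ((b + 1) - x)%R)%E.
    by apply: eq_integral => x _; rewrite -[in RHS](addrAC b) gP.
  congr (integral _ _ _); apply/seteqP; split => x /=; rewrite !in_itv /=;
    by move=> /andP[h1 h2]; apply/andP; split; lra.
Qed.

Lemma integral_torus_reflect b g :
  measurable_fun [set: R] g -> (forall x, g (x + 1) = g x) ->
  (\int[leb]_(x in torus) g (b - x)%R = \int[leb]_(x in torus) g x)%E.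
Proof.
move=> mg gP; rewrite integralE [RHS]integralE; congr (_ - _)%E.
- rewrite -[RHS](@ge0_integral_torus_reflect b)//.
  + by apply: eq_integral => x _; rewrite !funeposE.
  + exact: measurable_funepos.
  + by move=> x; rewrite !funeposE gP.
- rewrite -[RHS](@ge0_integral_torus_reflect b)//.
  + by apply: eq_integral => x _; rewrite !funenegE.
  + exact: measurable_funeneg.
  + by move=> x; rewrite !funenegE gP.
Qed.

Lemma avg_reflect b f : measurable_fun [set: R] f ->
  (forall x, f (x + 1) = f x) -> avg (fun x => f (b - x)) = avg f.
Proof.
move=> mf fP; rewrite !avg.unlock /Rintegral; congr fine.
rewrite (@integral_torus_reflect b (EFin \o f))//.
- exact/measurable_EFinP.
- by move=> x /=; rewrite fP.
Qed.

Lemma L1_reflect b f : measurable_fun [set: R] f ->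
  (forall x, f (x + 1) = f x) -> L1 f -> L1 (fun x => f (b - x)).
Proof.
move=> mf fP /integrableP[mfT foo]; apply/integrableP; split.
  apply/measurable_EFinP; apply: measurable_funTS.
  by apply: measurableT_comp => //; exact: measurable_reflect.
rewrite (@integral_torus_reflect b (fun x => `|(f x)%:E|)%E)//.
- by apply: measurableT_comp => //; exact/measurable_EFinP.
- by move=> x /=; rewrite fP.
Qed.

Lemma lebesgue_torus_reflect b (A : set R) : measurable (A : set (measurableTypeR R)) ->
  (forall x, A (x + 1) = A x) ->
  leb (torus `&` (fun x => b - x) @^-1` A) = leb (torus `&` A).
Proof.
move=> mA AP.
have mB : measurable ((fun x => b - x) @^-1` A).
  by rewrite -[X in measurable X]setTI; exact: measurable_reflect.
rewrite ![torus `&` _]setIC.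
rewrite -(integral_indic leb measurable_torus mA).
rewrite -(integral_indic leb measurable_torus mB).
rewrite -(@integral_torus_reflect b (EFin \o \1_A))//.
- apply/measurable_EFinP; exact: measurable_indic.
- move=> x /=; rewrite !indicE (_ : (x + 1 \in A) = (x \in A))//.
  by apply/idP/idP; rewrite !inE AP.
Qed.

(** A translation is the composite of two reflections. *)
Lemma lebesgue_torus_shift p (A : set R) : measurable (A : set (measurableTypeR R)) ->
  (forall x, A (x + 1) = A x) ->
  leb (torus `&` (fun x => x + p) @^-1` A) = leb (torus `&` A).
Proof.
move=> mA AP; rewrite -[RHS](@lebesgue_torus_reflect p)//.
rewrite -[RHS](@lebesgue_torus_reflect 0).
- by congr (leb (_ `&` _)); apply/funext => x /=; rewrite sub0r opprK addrC.
- by rewrite -[X in measurable X]setTI; exact: measurable_reflect.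
- by move=> x /=; rewrite opprD addrA -[LHS]AP subrK.
Qed.

End TorusGeometry.

(** * Fubini's theorem on the torus *)

Section TorusFubini.
Context {R : realType}.
Implicit Types (f h : R -> R) (M : R).

Local Notation leb := (@lebesgue_measure R).
Local Notation torus := (@torus R).
Local Notation mR := (measurableTypeR R).

Lemma restrict_torusE f x :
  (f \_ torus) x = if x \in torus then f x else 0.
Proof. by rewrite patchE. Qed.

Lemma integral_restrict_torus f :
  (\int[leb]_x ((f \_ torus) x)%:E = \int[leb]_(x in torus) (f x)%:E)%E.
Proof.
rewrite [RHS]integral_mkcond; apply: eq_integral => x _.
by rewrite !patchE; case: ifP.
Qed.

Lemma L1_restrict_torus f :
  leb.-integrable [set: mR] (fun x => ((f \_ torus) x)%:E) <-> L1 f.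
Proof.
rewrite /L1 (integrable_mkcond _ measurable_torus).
suff -> : (EFin \o f) \_ torus = (fun x => ((f \_ torus) x)%:E) by [].
by apply/funext => x; rewrite !patchE /=; case: ifP.
Qed.

Variables (k : mR * mR -> R) (f h : R -> R) (M : R).
Hypotheses (mk : measurable_fun [set: mR * mR] k) (kM : forall z, `|k z| <= M).
Hypotheses (Lf : L1 f) (Lh : L1 h).

Let F (z : mR * mR) : R := k z * (f \_ torus) z.1 * (h \_ torus) z.2.

Let M_ge0 : 0 <= M. Proof. exact: le_trans (kM point). Qed.

Let mres g : L1 g -> measurable_fun [set: mR] (g \_ torus).
Proof.
move=> Lg; apply/(measurable_restrictT _ _).1; first exact: measurable_torus.
exact: L1_measurable.
Qed.

Let mF : measurable_fun [set: mR * mR] F.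
Proof.
apply: measurable_funM; first apply: measurable_funM => //.
- by apply: (measurableT_comp (mres Lf)); exact: measurable_fst.
- by apply: (measurableT_comp (mres Lh)); exact: measurable_snd.
Qed.

Let int_norm g : L1 g ->
  (\int[leb]_x `|(g \_ torus) x|%:E = (avg (fun x => `|g x|))%:E)%E.
Proof.
move=> Lg; rewrite -avg_EFin; last exact: L1_norm.
rewrite -integral_restrict_torus; apply: eq_integral => x _.
by rewrite !patchE; case: ifP => //; rewrite normr0.
Qed.

Let integrable_F :
  (leb \x leb)%E.-integrable [set: mR * mR] (EFin \o F).
Proof.
have mEF : measurable_fun [set: mR * mR] (EFin \o F) by exact/measurable_EFinP.
apply/(integrable12ltyP _ _ mEF).
have mnorm g : L1 g -> measurable_fun [set: mR] (fun x => `|(g \_ torus) x|%:E)%E.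
  by move=> Lg; apply/measurable_EFinP; apply: measurableT_comp => //; exact: mres.
pose C := avg (fun x => `|h x|).
have C_ge0 : 0 <= C by apply: avg_ge0.
have inner x : (\int[leb]_y `|(EFin \o F) (x, y)| <=
    (M * C)%:E * `|(f \_ torus) x|%:E)%E.
  apply: (@le_trans _ _ (\int[leb]_y ((M * `|(f \_ torus) x|)%:E * `|(h \_ torus) y|%:E))%E).
    apply: ge0_le_integral => //.
    - apply: measurableT_comp => //; apply/measurable_EFinP.
      exact: (measurable_fun_pair2 x mF).
    - apply: measurable_funeM; exact: mnorm.
    - move=> y _ /=; rewrite lee_fin /F !normrM /=.
      by rewrite !ler_wpM2r// kM.
  rewrite ge0_integralZl_EFin//; last first.
    by rewrite mulr_ge0.
  - exact: mnorm.
  by rewrite int_norm// -!EFinM lee_fin mulrAC.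
apply: (@le_lt_trans _ _ (\int[leb]_x ((M * C)%:E * `|(f \_ torus) x|%:E))%E).
  apply: ge0_le_integral => //.
  - by move=> x _; exact: integral_ge0.
  - apply: (measurable_fun_fubini_tonelli_F (abse \o (EFin \o F))) => //=.
    exact: measurableT_comp.
  - apply: measurable_funeM; exact: mnorm.
rewrite ge0_integralZl_EFin//; last by rewrite mulr_ge0.
- by rewrite int_norm// -EFinM ltry.
- exact: mnorm.
Qed.

Lemma L1_section1 x : L1 (fun y => k (x, y) * h y).
Proof.
apply: eq_L1 (fun y _ => mulrC (h y) (k (x, y))) _.
apply: (@L1M_bounded _ _ _ M) => //; apply: measurable_funTS.
exact: (measurable_fun_pair2 x mk).
Qed.

Lemma L1_section2 y : L1 (fun x => k (x, y) * f x).
Proof.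
apply: eq_L1 (fun x _ => mulrC (f x) (k (x, y))) _.
apply: (@L1M_bounded _ _ _ M) => //; apply: measurable_funTS.
exact: (measurable_fun_pair1 y mk).
Qed.

Let F1 : fubini_F leb (EFin \o F) =
  fun x => (((fun x => f x * avg (fun y => k (x, y) * h y)) \_ torus) x)%:E.
Proof.
apply/funext => x; rewrite /fubini_F.
transitivity (\int[leb]_y (((fun y => (f \_ torus) x * (k (x, y) * h y)) \_ torus) y)%:E)%E.
  apply: eq_integral => y _; rewrite /= /F /= 2!(restrict_torusE _ y).
  by case: ifP => _; congr EFin; ring.
rewrite integral_restrict_torus avg_EFin; last by apply: L1Z; exact: L1_section1.
rewrite avgZ; last exact: L1_section1.
by rewrite !restrict_torusE; case: ifP => _ //; rewrite mul0r.
Qed.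

Let F2 : fubini_G leb (EFin \o F) =
  fun y => (((fun y => h y * avg (fun x => k (x, y) * f x)) \_ torus) y)%:E.
Proof.
apply/funext => y; rewrite /fubini_G.
transitivity (\int[leb]_x (((fun x => (h \_ torus) y * (k (x, y) * f x)) \_ torus) x)%:E)%E.
  apply: eq_integral => x _; rewrite /= /F /= 2!(restrict_torusE _ x).
  by case: ifP => _; congr EFin; ring.
rewrite integral_restrict_torus avg_EFin; last by apply: L1Z; exact: L1_section2.
rewrite avgZ; last exact: L1_section2.
by rewrite !restrict_torusE; case: ifP => _ //; rewrite mul0r.
Qed.

Let integral_F :
  (\int[leb \x leb]_(z in torus `*` torus) (k z * f z.1 * h z.2)%:E =
   \int[leb \x leb]_z (F z)%:E)%E.
Proof.
rewrite integral_mkcond; apply: eq_integral => z _; rewrite patchE /F !restrict_torusE.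
have [[z1 z2]|/not_andP z12] := pselect ((torus `*` torus) z).
  by rewrite !mem_set.
rewrite memNset; last by case: z12 => ? [].
case: z12 => zT.
  by rewrite (_ : z.1 \in torus = false) ?mulr0 ?mul0r//; apply: memNset.
by rewrite (_ : z.2 \in torus = false) ?mulr0//; apply: memNset.
Qed.

(** Together with [integral_torus21] this is Fubini's theorem for a bounded kernel
    and integrable densities on the torus. *)
Lemma integral_torus12 :
  (\int[leb \x leb]_(z in torus `*` torus) (k z * f z.1 * h z.2)%:E =
   (avg (fun x => f x * avg (fun y => k (x, y) * h y)))%:E)%E.
Proof.
rewrite integral_F -(integral12_prod_meas1 integrable_F) F1.
rewrite integral_restrict_torus avg_EFin//.
by apply/L1_restrict_torus; rewrite -F1; exact: integrable_fubini_F.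
Qed.

Lemma integral_torus21 :
  (\int[leb \x leb]_(z in torus `*` torus) (k z * f z.1 * h z.2)%:E =
   (avg (fun y => h y * avg (fun x => k (x, y) * f x)))%:E)%E.
Proof.
rewrite integral_F -(integral21_prod_meas1 integrable_F) F2.
rewrite integral_restrict_torus avg_EFin//.
apply: (@L1_le _ _ (fun y => M * avg (fun x => `|f x|) * h y)).
- apply/(measurable_restrictT _ _); first exact: measurable_torus.
  apply/measurable_EFinP.
  by have := measurable_fubini_G integrable_F; rewrite F2.
- exact: L1Z.
- move=> y _; rewrite !normrM mulrC ler_wpM2r//.
  apply: (le_trans (le_normr_avg (L1_section2 y))).
  rewrite (ger0_norm M_ge0) (ger0_norm (avg_ge0 _))// -avgZ; last exact: L1_norm.
  apply: le_avg => [||x _]; first by apply: L1_norm; exact: L1_section2.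
    by apply: L1Z; exact: L1_norm.
  by rewrite normrM ler_wpM2r.
Qed.

End TorusFubini.

(** * Convolution with an even periodic kernel *)

Section Convolution.
Context {R : realType}.
Implicit Types (K f h : R -> R) (x y b c t L M : R).

Local Notation leb := (@lebesgue_measure R).
Local Notation torus := (@torus R).

Lemma lipschitz_continuous f L :
  (forall x y, `|f x - f y| <= L * `|x - y|) -> continuous f.
Proof.
move=> fL x; apply/cvgrPdist_lt => e e0.
have L0 : 0 < `|L| + 1 by rewrite ltr_wpDl.
near=> y; apply: (le_lt_trans (fL x y)).
apply: (@le_lt_trans _ _ ((`|L| + 1) * `|x - y|)).
  by rewrite ler_wpM2r// (le_trans (ler_norm L))// lerDl.
rewrite mulrC -ltr_pdivlMr//; near: y.
by apply: cvgr_dist_lt => //; rewrite divr_gt0.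
Unshelve. all: by end_near. Qed.

Lemma continuous_gt f x c : {for x, continuous f} -> c < f x ->
  exists2 e, 0 < e & forall y, `|x - y| < e -> c < f y.
Proof.
move=> cf cfx; have : \forall y \near x, c < f y by exact: (cvgr_gt (f x) cf).
by move=> /nbhs_ballP[e /= e0 H]; exists e.
Qed.

(** Were the function positive at [x], it would be so on an interval of the
    torus. *)
Lemma avg_le0_eq0 f x : L1 f -> (forall y, 0 <= f y) ->
  (forall y, f (y + 1) = f y) -> avg f <= 0 -> {for x, continuous f} -> f x = 0.
Proof.
move=> Lf f0 fP If cf; apply/eqP; rewrite eq_le f0 andbT leNgt; apply/negP => fx0.
have [e e0 He] := continuous_gt cf fx0.
have [m tE] := torus_repr_shift x; set t := torus_repr x in tE.
have : torus t by exact: torus_repr_in.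
rewrite /torus /= in_itv /= => /andP[t0 t1].
pose s := Num.min (t + e) 1.
have ts : t < s by rewrite lt_min t1 ltrDl e0.
have [s1 se] : s <= 1 /\ s <= t + e by split; rewrite ge_min lexx ?orbT.
have sub : `]t, s[%classic `<=` ~` [set y | torus y -> f y = 0].
  move=> y /=; rewrite in_itv /= => /andP[ty ys] H.
  have : 0 < f (y - m%:~R).
    apply: He; rewrite ltr_norml; apply/andP; split; lra.
  rewrite -mulrNz periodic_int// H ?ltxx//.
  by rewrite /torus /= in_itv /=; apply/andP; split; lra.
have [A [mA A0 sA]] := avg_le0_ae Lf (fun y _ => f0 y) If.
have : (leb `]t, s[%classic <= leb A)%E.
  apply: le_measure; [apply/mem_set|exact/mem_set|by move=> y /sub /sA].
  exact: measurable_itv.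
by rewrite A0 lebesgue_measure_itv/= lte_fin ts -EFinB lee_fin leNgt subr_gt0 ts.
Qed.

Record is_kernel K : Prop := IsKernel {
  kernel_lipschitz : exists L, forall x y, `|K x - K y| <= L * `|x - y| ;
  kernel_even : forall x, K (- x) = K x ;
  kernel_periodic : forall x, K (x + 1) = K x }.

Lemma kernel_continuous K : is_kernel K -> continuous K.
Proof. by case=> [[L KL] _ _]; exact: lipschitz_continuous KL. Qed.

Lemma kernel_measurable K : is_kernel K -> measurable_fun [set: R] K.
Proof. by move=> /kernel_continuous; exact: continuous_measurable_fun. Qed.

Lemma kernel_bounded K : is_kernel K -> exists M, forall x, `|K x| <= M.
Proof.
case=> [[L KL] _ KP]; exists (`|K 0| + `|L|) => x.
rewrite -(periodic_centered _ KP) -[X in `|X|](subrK (K 0)) addrC.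
apply: (le_trans (ler_normD _ _)); rewrite lerD2l (le_trans (KL _ _))// subr0.
rewrite (@le_trans _ _ (`|L| * `|centered x|))//.
  by rewrite ler_wpM2r// ler_norm.
by rewrite ler_piMr// (le_trans (cdist_le_half x))//; lra.
Qed.

Lemma measurable_shift_kernel K x : is_kernel K ->
  measurable_fun [set: R] (fun y => K (x - y)).
Proof.
move=> kK; apply: (measurableT_comp (kernel_measurable kK)).
exact: measurable_reflect.
Qed.

Definition conv K f x : R := avg (fun y => K (x - y) * f y).

(** The interaction term of the free energy is minus half the diagonal of this
    bilinear form, for [K] minus the potential. *)
Definition energy K f h : R := avg (fun x => f x * conv K h x).

Section Kernel.
Variables (K : R -> R).
Hypothesis kK : is_kernel K.

Lemma L1_conv f x : L1 f -> L1 (fun y => K (x - y) * f y).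
Proof.
move=> Lf; have [M KM] := kernel_bounded kK.
apply: eq_L1 (fun y _ => mulrC (f y) (K (x - y))) _.
apply: (@L1M_bounded _ _ _ M) => //; apply: measurable_funTS.
exact: measurable_shift_kernel.
Qed.

Lemma convD f h x : L1 f -> L1 h ->
  conv K (fun y => f y + h y) x = conv K f x + conv K h x.
Proof.
move=> Lf Lh; rewrite /conv -avgD; [|exact: L1_conv..].
by apply: eq_avg => y _; rewrite mulrDr.
Qed.

Lemma convZ c f x : L1 f -> conv K (fun y => c * f y) x = c * conv K f x.
Proof.
move=> Lf; rewrite /conv -avgZ; last exact: L1_conv.
by apply: eq_avg => y _; rewrite mulrCA.
Qed.

Lemma convN f x : L1 f -> conv K (fun y => - f y) x = - conv K f x.
Proof.
move=> Lf; rewrite -mulN1r -convZ//.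
by apply: eq_avg => y _; rewrite mulN1r.
Qed.

Lemma convB f h x : L1 f -> L1 h ->
  conv K (fun y => f y - h y) x = conv K f x - conv K h x.
Proof. by move=> Lf Lh; rewrite convD ?convN//; exact: L1N. Qed.

Lemma conv_periodic f x : conv K f (x + 1) = conv K f x.
Proof.
by apply: eq_avg => y _; rewrite addrAC kernel_periodic.
Qed.

Lemma conv_lipschitz f : L1 f ->
  exists L, forall x y, `|conv K f x - conv K f y| <= L * `|x - y|.
Proof.
move=> Lf; have [[L KL] _ _] := kK; exists (L * avg (fun y => `|f y|)) => x y.
have LB : L1 (fun z => K (x - z) * f z - K (y - z) * f z) by apply: L1B; exact: L1_conv.
rewrite /conv -avgB; [|exact: L1_conv..].
apply: (le_trans (le_normr_avg LB)).
rewrite mulrAC -avgZ; last exact: L1_norm.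
apply: le_avg => [||z _]; [exact: L1_norm|by apply: L1Z; exact: L1_norm|].
rewrite -mulrBl normrM ler_wpM2r//.
by apply: (le_trans (KL _ _)); rewrite opprB addrA subrK.
Qed.

Lemma conv_continuous f : L1 f -> continuous (conv K f).
Proof. by move=> /conv_lipschitz[L]; exact: lipschitz_continuous. Qed.

Lemma conv_measurable f : L1 f -> measurable_fun [set: R] (conv K f).
Proof. by move=> /conv_continuous; exact: continuous_measurable_fun. Qed.

Lemma conv_bounded f : L1 f -> exists M, forall x, `|conv K f x| <= M.
Proof.
move=> Lf; have [M KM] := kernel_bounded kK; exists (M * avg (fun y => `|f y|)) => x.
apply: (le_trans (le_normr_avg (L1_conv x Lf))).
rewrite -avgZ; last exact: L1_norm.
apply: le_avg => [||z _]; [|by apply: L1Z; exact: L1_norm|].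
  by apply: L1_norm; exact: L1_conv.
by rewrite normrM ler_wpM2r.
Qed.

Lemma L1_energy f h : L1 f -> L1 h -> L1 (fun x => f x * conv K h x).
Proof.
move=> Lf Lh; have [M cM] := conv_bounded Lh.
by apply: (@L1M_bounded _ _ _ M) => //; apply: measurable_funTS; exact: conv_measurable.
Qed.

(** Convolution with an even kernel commutes with the isometries of the circle. *)
Lemma conv_reflect f b x : measurable_fun [set: R] f ->
  (forall y, f (y + 1) = f y) -> conv K (fun y => f (b - y)) x = conv K f (b - x).
Proof.
move=> mf fP; rewrite /conv -[RHS](@avg_reflect _ b).
- apply: eq_avg => y _; rewrite -(kernel_even kK (x - y)); congr (K _ * _); ring.
- by apply: measurable_funM => //; exact: measurable_shift_kernel.
- by move=> y; rewrite fP opprD addrA -(kernel_periodic kK) subrK.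
Qed.

Let measurable_diff : measurable_fun [set: measurableTypeR R * measurableTypeR R]
  (fun z : measurableTypeR R * measurableTypeR R => K (z.1 - z.2)).
Proof.
apply: (measurableT_comp (kernel_measurable kK)).
apply: measurable_funB; [exact: measurable_fst|exact: measurable_snd].
Qed.

Lemma energy_prod f h : L1 f -> L1 h ->
  (\int[leb \x leb]_(z in torus `*` torus) (K (z.1 - z.2) * f z.1 * h z.2)%:E =
   (energy K f h)%:E)%E.
Proof.
move=> Lf Lh; have [M KM] := kernel_bounded kK.
exact: (@integral_torus12 _ _ _ _ M measurable_diff (fun z => KM _) Lf Lh).
Qed.

Lemma energyC f h : L1 f -> L1 h -> energy K f h = energy K h f.
Proof.
move=> Lf Lh; apply: EFin_inj; rewrite -energy_prod//.
have [M KM] := kernel_bounded kK.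
rewrite (@integral_torus21 _ _ _ _ M measurable_diff (fun z => KM _) Lf Lh) /=.
congr EFin; apply: eq_avg => y _; congr (_ * _); apply: eq_avg => x _.
by rewrite -(kernel_even kK) opprB.
Qed.

Lemma energyDl f1 f2 h : L1 f1 -> L1 f2 -> L1 h ->
  energy K (fun x => f1 x + f2 x) h = energy K f1 h + energy K f2 h.
Proof.
move=> L1f L2f Lh; rewrite /energy -avgD; [|exact: L1_energy..].
by apply: eq_avg => x _; rewrite mulrDl.
Qed.

Lemma energyZl c f h : L1 f -> L1 h ->
  energy K (fun x => c * f x) h = c * energy K f h.
Proof.
move=> Lf Lh; rewrite /energy -avgZ; last exact: L1_energy.
by apply: eq_avg => x _; rewrite mulrA.
Qed.

Lemma energy_line f h t : L1 f -> L1 h ->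
  energy K (fun x => f x + t * h x) (fun x => f x + t * h x) =
  energy K f f + 2 * t * energy K h f + t ^+ 2 * energy K h h.
Proof.
move=> Lf Lh; have Lth := L1Z t Lh; have Lsum := L1D Lf Lth.
rewrite energyDl// energyZl// [energy K f _]energyC// [energy K h _]energyC//.
rewrite !energyDl// !energyZl// [energy K f h]energyC//; ring.
Qed.

End Kernel.

End Convolution.

(** * The free energy as a functional of the density, and its Euler--Lagrange equation *)

Section FreeEnergy.
Context {R : realType}.
Implicit Types (K f h r : R -> R) (a b c t M x : R).

Local Notation leb := (@lebesgue_measure R).
Local Notation torus := (@torus R).

(** The pointwise form of Gibbs' inequality: the graph of [xlogx] lies above its
    tangent at [b]. *)
Lemma xlogx_tangent a b : 0 <= a -> 0 < b ->
  a * ln b + a - b <= xlogx a ?= iff (a == b).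
Proof.
move=> a0 b0; apply/leifP; case: eqVneq => [->|ab].
  by rewrite /xlogx addrK.
have [->|aN0] := eqVneq a 0; first by rewrite /xlogx !mul0r !add0r oppr_lt0.
have {aN0}a_gt0 : 0 < a by rewrite lt_neqAle eq_sym aN0.
have q0 : 0 < b / a by rewrite divr_gt0.
have : 1 + ln (b / a) < b / a.
  rewrite -[X in _ < X](lnK q0); apply: expR_gt1Dx.
  rewrite ln_eq0//; apply: contra ab => /eqP q1.
  by rewrite -[b](divfK (lt0r_neq0 a_gt0)) q1 mul1r.
rewrite ln_div// -(ltr_pM2l a_gt0) mulrCA divff ?gt_eqF// mulr1 /xlogx.
lra.
Qed.

Lemma xlogx_ge a : 0 <= a -> - 1 <= xlogx a.
Proof.
move=> a0; have [h _] := xlogx_tangent a0 (@ltr01 R).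
by apply: le_trans h; rewrite ln1; lra.
Qed.

Lemma xlogx_convex a b t : 0 <= a -> 0 < b -> 0 < t <= 1 ->
  xlogx (a + t * (b - a)) <= xlogx a + t * (xlogx b - xlogx a).
Proof.
move=> a0 b0 /andP[t0 t1].
have [c cE] : exists c, c = (1 - t) * a + t * b by exists ((1 - t) * a + t * b).
have -> : a + t * (b - a) = c by rewrite cE; ring.
have c0 : 0 < c by rewrite cE ltr_wpDl ?mulr_ge0 ?mulr_gt0// subr_ge0.
have [ha _] := xlogx_tangent a0 c0; have [hb _] := xlogx_tangent (ltW b0) c0.
have ha' : (1 - t) * (a * ln c + a - c) <= (1 - t) * xlogx a.
  by rewrite ler_wpM2l// subr_ge0.
have hb' : t * (b * ln c + b - c) <= t * xlogx b by rewrite ler_wpM2l// ltW.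
have : (1 - t) * (a * ln c + a - c) + t * (b * ln c + b - c) =
    ((1 - t) * a + t * b) * ln c + ((1 - t) * a + t * b) - c by ring.
by rewrite -cE addrK -/(xlogx c); lra.
Qed.

Lemma xlogx_bounded a M : 0 <= a <= M -> `|xlogx a| <= M ^+ 2 + 1.
Proof.
move=> /andP[a0 aM]; have M2 : 0 <= M ^+ 2 by exact: sqr_ge0.
rewrite ler_norml; apply/andP; split; first by have := xlogx_ge a0; lra.
apply: (@le_trans _ _ (M ^+ 2)); last by lra.
move: a0; rewrite le_eqVlt => /predU1P[<-|a0]; first by rewrite /xlogx mul0r.
apply: (@le_trans _ _ (a * a)); last by rewrite expr2 ler_pM// ltW.
by rewrite /xlogx ler_pM2l// ltW// ln_sublinear.
Qed.

Lemma measurable_xlogx f : measurable_fun torus f ->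
  measurable_fun torus (fun x => xlogx (f x)).
Proof.
move=> mf; apply: measurable_funM => //.
by apply: measurableT_comp => //; exact: measurable_ln.
Qed.

(** The integrand [f ln f - f ln r - f + r] of the relative entropy is nonnegative
    and vanishes only where [f] and [r] agree. *)
Lemma gibbs f r : L1 f -> L1 (fun x => xlogx (f x)) -> L1 r ->
  L1 (fun x => f x * ln (r x)) ->
  (forall x, torus x -> 0 <= f x) -> (forall x, torus x -> 0 < r x) ->
  avg f = avg r -> avg (fun x => xlogx (f x)) <= avg (fun x => f x * ln (r x)) ->
  ae_eq leb torus f r.
Proof.
move=> Lf Lxf Lr Lfr f0 r0 fr H.
pose g x := xlogx (f x) - (f x * ln (r x) + f x - r x).
have Lg : L1 g by apply: L1B => //; apply: L1B => //; exact: L1D.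
have g0 x : torus x -> 0 <= g x.
  by move=> Tx; rewrite subr_ge0; have [] := xlogx_tangent (f0 _ Tx) (r0 _ Tx).
have : avg g <= 0.
  rewrite avgB//; last by apply: L1B => //; exact: L1D.
  rewrite avgB//; last exact: L1D.
  by rewrite avgD//; lra.
move=> /(avg_le0_ae Lg g0); apply: filterS => x gx Tx.
have [_] := xlogx_tangent (f0 _ Tx) (r0 _ Tx).
by have /eqP := gx Tx; rewrite /g subr_eq0 eq_sym => -> /esym /eqP.
Qed.

(** The densities of finite entropy, on which the free energy is finite. *)
Record admissible f : Prop := Admissible {
  admissible_ge0 : forall x, torus x -> 0 <= f x ;
  admissible_L1 : L1 f ;
  admissible_mass : avg f = 1 ;
  admissible_entropy : L1 (fun x => xlogx (f x)) }.

Lemma bounded_admissible f M : measurable_fun torus f ->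
  (forall x, torus x -> 0 <= f x <= M) -> avg f = 1 -> admissible f.
Proof.
move=> mf fM f1; split => //.
- by move=> x /fM /andP[].
- by apply: (@L1_bounded _ _ M) => // x /fM /andP[f0 ?]; rewrite ger0_norm.
- apply: (@L1_bounded _ _ (M ^+ 2 + 1)); first exact: measurable_xlogx.
  by move=> x /fM /xlogx_bounded.
Qed.

Definition free_functional K f : R := avg (fun x => xlogx (f x)) - 2^-1 * energy K f f.

Lemma admissible_cst1 : admissible (cst 1).
Proof.
apply: (@bounded_admissible _ 1) => //; last exact: avg_cst.
by move=> x _; rewrite lexx ler01.
Qed.

Lemma entropy_cst1 : avg (fun x => xlogx (cst 1 x)) = 0 :> R.
Proof.
rewrite (@eq_avg _ _ (cst 0)) ?avg_cst// => x _.
by rewrite /xlogx ln1 mulr0.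
Qed.

(** Relative entropy with respect to the uniform density is the entropy itself. *)
Lemma entropy_gt0 f : admissible f -> ~ ae_eq leb torus f (cst 1) ->
  0 < avg (fun x => xlogx (f x)).
Proof.
move=> [f0 Lf f1 Lx] fN1; rewrite ltNge; apply/negP => H; apply: fN1.
have f_ln1 x : f x * ln (cst 1 x) = cst 0 x by rewrite /= ln1 mulr0.
apply: gibbs => //.
- exact: L1_cst.
- by apply: eq_L1 (fun x _ => esym (f_ln1 x)) (L1_cst 0).
- by rewrite f1 avg_cst.
- by rewrite (eq_avg (fun x _ => f_ln1 x)) avg_cst.
Qed.

(** The entropy is convex along a segment and the interaction is quadratic, so the
    free energy is at most its first-order expansion at [f] plus a quadratic term.
    The endpoint [h] is positive so that only the tangent inequality of [xlogx] at
    positive points is needed. *)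
Lemma free_segment K f h t : is_kernel K -> admissible f -> admissible h ->
  (forall x, torus x -> 0 < h x) -> 0 < t <= 1 ->
  admissible (fun x => f x + t * (h x - f x)) /\
  free_functional K (fun x => f x + t * (h x - f x)) - free_functional K f <=
    t * (avg (fun x => xlogx (h x)) - avg (fun x => xlogx (f x))
         - energy K (fun x => h x - f x) f)
    - 2^-1 * t ^+ 2 * energy K (fun x => h x - f x) (fun x => h x - f x).
Proof.
move=> kK [f0 Lf f1 Lxf] [_ Lh h1 Lxh] h0 t01; have /andP[t0 t1] := t01.
set s := fun x => f x + t * (h x - f x).
have Ld : L1 (fun x => h x - f x) by exact: L1B.
have Ls : L1 s by apply: L1D => //; exact: L1Z.
have s0 x : torus x -> 0 <= s x.
  move=> Tx; have -> : s x = (1 - t) * f x + t * h x by rewrite /s; ring.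
  by rewrite addr_ge0// mulr_ge0 ?f0 ?(ltW (h0 _ _)) ?subr_ge0// ltW.
have Lub : L1 (fun x => xlogx (f x) + t * (xlogx (h x) - xlogx (f x))).
  by apply: L1D => //; apply: L1Z; exact: L1B.
have sub x : torus x -> xlogx (s x) <= xlogx (f x) + t * (xlogx (h x) - xlogx (f x)).
  by move=> Tx; apply: xlogx_convex => //; [exact: f0|exact: h0].
have Lxs : L1 (fun x => xlogx (s x)).
  apply: (@L1_le _ _ (fun x => `|xlogx (f x) + t * (xlogx (h x) - xlogx (f x))| + 1)).
  - by apply: measurable_xlogx; exact: L1_measurable.
  - by apply: L1D; [exact: L1_norm|exact: L1_cst].
  - move=> x Tx; have := xlogx_ge (s0 _ Tx); have := sub _ Tx.
    set u := _ + t * _ => su s1; have := ler_norm u; have := normr_ge0 u => u0 ul.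
    rewrite (ger0_norm (addr_ge0 u0 ler01)) ler_norml; apply/andP; split; lra.
split.
  split=> //; rewrite /s avgD//; last exact: L1Z.
  by rewrite avgZ// avgB// f1 h1; ring.
rewrite /free_functional energy_line//.
have : avg (fun x => xlogx (s x)) <=
    avg (fun x => xlogx (f x)) + t * (avg (fun x => xlogx (h x)) - avg (fun x => xlogx (f x))).
  apply: (le_trans (le_avg Lxs Lub sub)).
  by rewrite avgD ?avgZ ?avgB//; [exact: L1B|apply: L1Z; exact: L1B].
lra.
Qed.

(** Divide by [t] and let [t] tend to 0. *)
Lemma linear_coef_ge0 (A C : R) :
  (forall t, 0 < t <= 1 -> 0 <= t * A + t ^+ 2 * C) -> 0 <= A.
Proof.
move=> H; rewrite leNgt; apply/negP => A0.
have D0 : 0 < `|C| + 1 - A by have := normr_ge0 C; lra.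
have := H (- A / (2 * (`|C| + 1 - A))).
set t := - A / _.
have t0 : 0 < t by rewrite divr_gt0 ?mulr_gt0// oppr_gt0.
have tD : t * (2 * (`|C| + 1 - A)) = - A by rewrite divfK// gt_eqF// mulr_gt0.
have t1 : t <= 1.
  by rewrite ler_pdivrMr ?mulr_gt0// mul1r; have := normr_ge0 C; lra.
move=> /(_ _); rewrite t0 t1 => /(_ isT); apply/negP; rewrite -ltNge.
have -> : t * A + t ^+ 2 * C = t * (A + t * C) by ring.
rewrite pmulr_rlt0//.
have : t * C <= t * (`|C| + 1 - A).
  by rewrite ler_pM2l//; have := ler_norm C; lra.
lra.
Qed.

Definition gibbs_density K f x : R :=
  expR (conv K f x) / avg (fun y => expR (conv K f y)).

Section EulerLagrange.
Variables (K f : R -> R).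
Hypotheses (kK : is_kernel K) (Lf : L1 f).

Let e x : R := expR (conv K f x).

Let continuous_e : continuous e.
Proof.
move=> x; apply: (@continuous_comp _ _ _ (conv K f) expR).
  exact: conv_continuous.
exact: continuous_expR.
Qed.

Let bounded_e : exists2 M, 0 < M & forall x, M^-1 <= e x <= M.
Proof.
have [M cM] := conv_bounded kK Lf; exists (expR M); first exact: expR_gt0.
move=> x; have := cM x; rewrite ler_norml => /andP[h1 h2].
by rewrite -expRN !ler_expR h1.
Qed.

Let L1_e : L1 e.
Proof.
have [M _ eM] := bounded_e; apply: (@L1_bounded _ _ M).
  by apply: measurable_funTS; exact: continuous_measurable_fun.
by move=> x _; rewrite ger0_norm ?expR_ge0//; have /andP[] := eM x.
Qed.

Lemma partition_gt0 : 0 < avg e.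
Proof.
have [M M0 eM] := bounded_e.
apply: (@lt_le_trans _ _ M^-1); first by rewrite invr_gt0.
rewrite -[X in X <= _](avg_cst M^-1); apply: le_avg => //; first exact: L1_cst.
by move=> x _; have /andP[] := eM x.
Qed.

Lemma gibbs_density_gt0 x : 0 < gibbs_density K f x.
Proof. by rewrite divr_gt0 ?expR_gt0// partition_gt0. Qed.

Lemma gibbs_density_continuous : continuous (gibbs_density K f).
Proof.
move=> x; rewrite /gibbs_density; apply: cvgM; first exact: continuous_e.
exact: cvg_cst.
Qed.

Lemma gibbs_density_periodic x : gibbs_density K f (x + 1) = gibbs_density K f x.
Proof. by rewrite /gibbs_density conv_periodic. Qed.

Lemma gibbs_density_bounded : exists M, forall x, gibbs_density K f x <= M.
Proof.
have [M M0 eM] := bounded_e; exists (M / avg e) => x.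
rewrite ler_pM2r ?invr_gt0 ?partition_gt0//.
by have /andP[] := eM x.
Qed.

Lemma gibbs_density_admissible : admissible (gibbs_density K f).
Proof.
have [M gM] := gibbs_density_bounded; apply: (@bounded_admissible _ M).
- apply: measurable_funTS; apply: continuous_measurable_fun.
  exact: gibbs_density_continuous.
- by move=> x _; rewrite gM ltW// gibbs_density_gt0.
- rewrite (@eq_avg _ _ (fun x => (avg e)^-1 * e x)); last first.
    by move=> x _; rewrite mulrC.
  by rewrite avgZ// mulVf// gt_eqF// partition_gt0.
Qed.

Lemma ln_gibbs_density x : ln (gibbs_density K f x) = conv K f x - ln (avg e).
Proof. by rewrite /gibbs_density ln_div ?expRK// posrE ?expR_gt0 ?partition_gt0. Qed.

(** Moving from [f] towards its Gibbs density [r], the first variation of the free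
    energy is minus the relative entropy of [f] with respect to [r], which
    minimality therefore makes nonpositive. *)
Lemma euler_lagrange : admissible f ->
  (forall h, admissible h -> free_functional K f <= free_functional K h) ->
  ae_eq leb torus f (gibbs_density K f).
Proof.
move=> af fmin; have ar := gibbs_density_admissible.
set r := gibbs_density K f in ar *; have [f0 _ f1 Lxf] := af.
have [_ Lr r1 Lxr] := ar.
have Lrf : L1 (fun x => r x - f x) by exact: L1B.
have L1ln h : L1 h -> L1 (fun x => h x * ln (r x)).
  move=> Lh; have := L1B (L1_energy kK Lh Lf) (L1Z (ln (avg e)) Lh).
  by apply: eq_L1 => x _; rewrite ln_gibbs_density; ring.
have avg_ln h : L1 h -> avg (fun x => h x * ln (r x)) = energy K h f - ln (avg e) * avg h.
  move=> Lh; rewrite -avgZ// -avgB//; [|exact: L1_energy|exact: L1Z].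
  by apply: eq_avg => x _; rewrite ln_gibbs_density; ring.
have first_variation : 0 <= avg (fun x => xlogx (r x)) - avg (fun x => xlogx (f x))
    - energy K (fun x => r x - f x) f.
  apply: (@linear_coef_ge0 _ (- (2^-1 * energy K (fun x => r x - f x) (fun x => r x - f x)))).
  move=> t t01; have [] := free_segment kK af ar (fun x _ => gibbs_density_gt0 x) t01.
  move=> /fmin; rewrite -subr_ge0 => h1 h2; apply: (le_trans h1); apply: (le_trans h2).
  by rewrite le_eqVlt; apply/orP; left; apply/eqP; ring.
apply: gibbs => //.
- exact: L1ln.
- by move=> x _; exact: gibbs_density_gt0.
- by rewrite f1.
- have -> : avg (fun x => f x * ln (r x)) = avg (fun x => xlogx (r x))
      - avg (fun x => (r x - f x) * ln (r x)).
    rewrite -avgB//; last exact: L1ln.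
    by apply: eq_avg => x _; rewrite /xlogx; ring.
  by rewrite avg_ln// avgB// f1 r1; lra.
Qed.

End EulerLagrange.

End FreeEnergy.

(** * Polarization *)

Section Polarization.
Context {R : realType}.
Implicit Types (K Q r : R -> R) (x y c s t : R).

Local Notation leb := (@lebesgue_measure R).
Local Notation torus := (@torus R).

(** Periodic functions that are odd under the reflection of the circle in the axis
    through [c] and [c + 1/2], and nonnegative on the half circle after [c]. *)
Record half_odd c Q : Prop := HalfOdd {
  half_odd_periodic : forall x, Q (x + 1) = Q x ;
  half_odd_odd : forall x, Q (2 * c - x) = - Q x ;
  half_odd_ge0 : forall x, c < x < c + 2^-1 -> 0 <= Q x }.

(** Both factors change sign across the axis, and vanish on it. *)
Lemma half_odd_mul_ge0 c Q1 Q2 x :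
  half_odd c Q1 -> half_odd c Q2 -> 0 <= Q1 x * Q2 x.
Proof.
move=> h1 h2; have [m uE] := centered_shift (x - c).
have /andP[u0 u1] := centered_bounds (x - c); set u := centered _ in uE u0 u1.
have red Q : half_odd c Q -> Q x = Q (c + u).
  move=> h; rewrite -(periodic_int x m (half_odd_periodic h)); congr Q.
  by rewrite uE; ring.
rewrite (red _ h1) (red _ h2) {red}.
have [u_gt0|u_le0] := ltP 0 u.
  by apply: mulr_ge0; [apply: (half_odd_ge0 h1)|apply: (half_odd_ge0 h2)];
      apply/andP; split; lra.
have neg Q : half_odd c Q -> u < 0 -> - 2^-1 < u -> Q (c + u) <= 0.
  move=> h ? ?; rewrite -oppr_ge0 -(half_odd_odd h).
  by apply: (half_odd_ge0 h); apply/andP; split; lra.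
have zero Q : half_odd c Q -> u = 0 \/ u = - 2^-1 -> Q (c + u) = 0.
  move=> h u01; have := half_odd_odd h (c + u).
  have -> : Q (2 * c - (c + u)) = Q (c + u).
    case: u01 => ->; first by congr Q; ring.
    by rewrite -[RHS](half_odd_periodic h); congr Q; lra.
  by lra.
have [u_lt0|u_eq0] : u < 0 \/ u = 0.
  by move: u_le0; rewrite le_eqVlt => /predU1P[|]; [right|left].
  move: u0; rewrite le_eqVlt => /predU1P[u_half|u_half].
    by rewrite (zero _ h1) ?mul0r//; right.
  by rewrite mulr_le0// neg.
by rewrite (zero _ h1) ?mul0r//; left.
Qed.

Lemma measurable_centered : measurable_fun [set: R] (@centered R).
Proof.
apply: measurable_funB => //.
have mfloor : measurable_fun [set: R] (fun x : R => (Num.floor x)%:~R : R).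
  apply: nondecreasing_measurable => // x y xy.
  by rewrite ler_int le_floor.
apply: (measurableT_comp mfloor); exact: measurable_funD.
Qed.

Section Kernel.
Variable K : R -> R.
Hypotheses (kK : is_kernel K)
  (K_dec : forall x y, cdist x <= cdist y -> K y <= K x)
  (K_max : forall x, 0 < cdist x -> K x < K 0).

(** The kernel decreases with the distance, and [cdist_reflect] compares the
    distances from [x] to a point on its side and to the mirror image. *)
Lemma half_odd_kernel c x : c < x < c + 2^-1 ->
  half_odd c (fun y => K (x - y) - K (x - (2 * c - y))).
Proof.
move=> /andP[x0 x1]; split=> [y|y|y /andP[y0 y1]].
- congr (_ - _).
    by rewrite -(kernel_periodic kK); congr K; ring.
  by rewrite -[RHS](kernel_periodic kK); congr K; ring.
- by rewrite [RHS]opprB; congr (_ - _); congr K; ring.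
- rewrite subr_ge0; apply: K_dec.
  have -> : x - y = (x - c) - (y - c) by ring.
  have -> : x - (2 * c - y) = (x - c) + (y - c) by ring.
  by apply: cdist_reflect; apply/andP; split; lra.
Qed.

Section HalfOddConv.
Variables (c : R) (Q : R -> R).
Hypotheses (mQ : measurable_fun [set: R] Q) (LQ : L1 Q) (hQ : half_odd c Q).

Lemma conv_odd x : conv K Q (2 * c - x) = - conv K Q x.
Proof.
rewrite -conv_reflect//; last exact: half_odd_periodic hQ.
by rewrite -convN//; apply: eq_avg => y _; rewrite (half_odd_odd hQ).
Qed.

(** Folding the convolution of an odd function along the axis replaces the kernel
    by its antisymmetrisation, which is nonnegative on the half circle. *)
Lemma conv_fold x :
  2 * conv K Q x = avg (fun y => (K (x - y) - K (x - (2 * c - y))) * Q y).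
Proof.
have Lr : L1 (fun y => K (x - (2 * c - y)) * Q y).
  apply: (@eq_L1 _ (fun y => K ((2 * c - x) - y) * Q y)); last exact: L1_conv.
  by move=> y _; rewrite -(kernel_even kK); congr (K _ * _); ring.
have -> : 2 * conv K Q x = conv K Q x - conv K Q (2 * c - x) by rewrite conv_odd; lra.
transitivity (conv K Q x - avg (fun y => K (x - (2 * c - y)) * Q y)).
  congr (_ - _); apply: eq_avg => y _.
  by rewrite -(kernel_even kK); congr (K _ * _); ring.
rewrite -avgB//; last exact: L1_conv.
by apply: eq_avg => y _; rewrite mulrBl.
Qed.

Lemma half_odd_conv : half_odd c (conv K Q).
Proof.
split=> [x|x|x xc]; first exact: conv_periodic.
  exact: conv_odd.
have : 0 <= 2 * conv K Q x.
  rewrite conv_fold; apply: avg_ge0 => y _.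
  exact: (half_odd_mul_ge0 y (half_odd_kernel xc) hQ).
by rewrite pmulr_rge0.
Qed.

Lemma half_odd_conv_gt0 x y : c < x < c + 2^-1 -> c < y < c + 2^-1 ->
  K (x - (2 * c - y)) < K (x - y) -> {for y, continuous Q} -> 0 < Q y ->
  0 < conv K Q x.
Proof.
move=> xc yc Kxy cQ Qy; rewrite lt_neqAle (half_odd_ge0 half_odd_conv xc) andbT.
apply/eqP => Kx0.
have hK := half_odd_kernel xc.
have cK : continuous (fun y => K (x - y) - K (x - (2 * c - y))).
  have cK1 : continuous (fun y => K (x - y)).
    move=> z; apply: (@continuous_comp _ _ _ (fun y => x - y) K).
      by apply: cvgB; [exact: cvg_cst|exact: cvg_id].
    exact: kernel_continuous.
  have cK2 : continuous (fun y => K (x - (2 * c - y))).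
    move=> z; apply: (@continuous_comp _ _ _ (fun y => x - (2 * c - y)) K).
      apply: cvgB; first exact: cvg_cst.
      by apply: cvgB; [exact: cvg_cst|exact: cvg_id].
    exact: kernel_continuous.
  by move=> z; apply: cvgB; [exact: cK1|exact: cK2].
have : (K (x - y) - K (x - (2 * c - y))) * Q y = 0.
  apply: (@avg_le0_eq0 _ (fun y => (K (x - y) - K (x - (2 * c - y))) * Q y)).
  - have [M KM] := kernel_bounded kK.
    apply: eq_L1 (fun y _ => mulrC (Q y) _) _.
    apply: (@L1M_bounded _ _ _ (M + M)) => //.
      by apply: measurable_funTS; exact: continuous_measurable_fun.
    by move=> z _; rewrite (le_trans (ler_normB _ _))// lerD.
  - by move=> z; exact: half_odd_mul_ge0 hK hQ.
  - by move=> z; rewrite (half_odd_periodic hK) (half_odd_periodic hQ).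
  - by rewrite -conv_fold -Kx0 mulr0.
  - by apply: cvgM; [exact: cK|exact: cQ].
by move=> /eqP; rewrite mulf_eq0 gt_eqF ?subr_gt0// gt_eqF.
Qed.

End HalfOddConv.

Variables (r : R -> R) (C : R).
Hypotheses (r_cont : continuous r) (r_per : forall x, r (x + 1) = r x)
  (r_gt0 : forall x, 0 < r x) (r_adm : admissible r)
  (r_bnd : exists M, forall x, r x <= M)
  (r_min : forall h, admissible h -> free_functional K r <= free_functional K h)
  (r_EL : forall x, ln (r x) = conv K r x - C).

Let mr : measurable_fun [set: R] r. Proof. exact: continuous_measurable_fun. Qed.

Let Lr : L1 r. Proof. exact: admissible_L1 r_adm. Qed.

Section Axis.
Variable c : R.

Local Notation refl x := (2 * c - x).

Let D x : R := r x - r (refl x).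

(** The odd extensions across the axis of the negative and positive parts that
    [D] has on the half circle after [c]; adding [N] to [r] polarises [r]. *)
Let N x : R :=
  if 0 <= centered (x - c) then Num.max (- D x) 0 else Num.min (- D x) 0.

Let P x : R := D x + N x.

Let rreflP x : r (refl (x + 1)) = r (refl x).
Proof. by rewrite -[LHS]r_per; congr r; ring. Qed.

Let D_per x : D (x + 1) = D x.
Proof. by rewrite /D r_per rreflP. Qed.

Let D_odd x : D (refl x) = - D x.
Proof. by rewrite /D [RHS]opprB; congr (_ - _); congr r; ring. Qed.

Let D_cont : continuous D.
Proof.
move=> x; apply: cvgB; first exact: r_cont.
apply: (@continuous_comp _ _ _ (fun y => refl y) r); last exact: r_cont.
by apply: cvgB; [exact: cvg_cst|exact: cvg_id].
Qed.

Let N_cases x : N x = 0 \/ N x = - D x.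
Proof.
by rewrite /N; case: ifP => _; [case: leP|case: leP] => _; [left|right|right|left].
Qed.

Let N_per x : N (x + 1) = N x.
Proof. by rewrite /N D_per addrAC centeredD1. Qed.

Let N_half x : c < x < c + 2^-1 -> N x = Num.max (- D x) 0.
Proof.
move=> /andP[x0 x1]; rewrite /N centered_id; last by apply/andP; split; lra.
by rewrite subr_ge0 ltW.
Qed.

Let N_odd x : N (refl x) = - N x.
Proof.
have [m uE] := centered_shift (x - c).
have /andP[u0 u1] := centered_bounds (x - c).
have uE' : centered (refl x - c) = centered (- centered (x - c)).
  rewrite uE -[RHS](periodic_int _ m centeredD1); congr centered; ring.
have D0 : centered (x - c) = 0 \/ centered (x - c) = - 2^-1 -> D x = 0.
  move=> h; rewrite /D; apply/eqP; rewrite subr_eq0; apply/eqP.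
  have xE : x = c + centered (x - c) - m%:~R by rewrite uE; ring.
  have -> : r x = r (c + centered (x - c)).
    by rewrite -(periodic_int x m r_per); congr r; rewrite {1}xE; ring.
  have -> : r (refl x) = r (c - centered (x - c)).
    rewrite -[RHS](periodic_int _ m r_per); congr r; rewrite {1}xE; ring.
  case: h => ->; first by rewrite subr0 addr0.
  by rewrite -r_per; congr r; lra.
move: u0; rewrite le_eqVlt => /predU1P[u0|u0].
  have Dx : D x = 0 by apply: D0; right.
  have DN : D (refl x) = 0 by rewrite D_odd Dx oppr0.
  by case: (N_cases x) (N_cases (refl x)) => ->; rewrite ?Dx => -[] ->; rewrite ?DN ?oppr0.
rewrite /N uE' centered_id; last by apply/andP; split; lra.
rewrite D_odd opprK oppr_ge0.
case: (ltgtP 0 (centered (x - c))) => [u_gt0|u_lt0|u_eq0].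
- by rewrite oppr_max opprK oppr0.
- by rewrite oppr_min opprK oppr0.
- by rewrite D0 ?oppr0 ?maxxx ?oppr0//; left.
Qed.

Let mD : measurable_fun [set: R] D. Proof. exact: continuous_measurable_fun. Qed.

Let mN : measurable_fun [set: R] N.
Proof.
have mND : measurable_fun [set: R] (fun x => - D x) by exact: measurable_funN.
apply: measurable_fun_ifT.
- apply: measurable_fun_ler => //; apply: (measurableT_comp measurable_centered).
  exact: measurable_funB.
- exact: measurable_maxr.
- exact: measurable_minr.
Qed.

Let L1_of_bounded Q : measurable_fun [set: R] Q ->
  (exists M, forall x, `|Q x| <= M) -> L1 Q.
Proof.
by move=> mQ [M QM]; apply: (@L1_bounded _ _ M) => //; exact: measurable_funTS.
Qed.

Let D_bounded : exists M, forall x, `|D x| <= M.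
Proof.
have [M rM] := r_bnd; exists M => x; have := r_gt0 x; have := r_gt0 (refl x).
by have := rM x; have := rM (refl x); rewrite /D ler_norml => *; apply/andP; split; lra.
Qed.

Let LD : L1 D. Proof. exact: L1_of_bounded. Qed.

Let LN : L1 N.
Proof.
apply: L1_of_bounded => //; have [M DM] := D_bounded; exists M => x.
by case: (N_cases x) => ->; rewrite ?normrN ?normr0// (le_trans _ (DM x)).
Qed.

Let mP : measurable_fun [set: R] P. Proof. exact: measurable_funD. Qed.

Let LP : L1 P. Proof. exact: L1D. Qed.

Let hN : half_odd c N.
Proof. by split=> // x xc; rewrite N_half// le_max lexx orbT. Qed.

Let hP : half_odd c P.
Proof.
split=> [x|x|x xc]; first by rewrite /P D_per N_per.
  by rewrite /P D_odd N_odd [RHS]opprD.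
by rewrite /P N_half// addrC -lerBlDr sub0r le_max lexx.
Qed.

Let f x : R := r x + N x.

Let mf : measurable_fun [set: R] f. Proof. exact: measurable_funD. Qed.

Let f_per x : f (x + 1) = f x. Proof. by rewrite /f r_per N_per. Qed.

Let f_swap x : (f x = r x /\ f (refl x) = r (refl x)) \/
  (f x = r (refl x) /\ f (refl x) = r x).
Proof.
rewrite /f N_odd; case: (N_cases x) => ->; [left|right].
  by rewrite oppr0 !addr0.
by rewrite /D; split; ring.
Qed.

(** Polarising permutes the two values of each mirror pair, so it preserves the mean
    of any [phi] of the density, in particular the mass and the entropy. *)
Let equimeasurable (phi : R -> R) : measurable_fun [set: R] phi ->
  (exists M, forall x, `|phi (r x)| <= M) ->
  avg (fun x => phi (f x)) = avg (fun x => phi (r x)).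
Proof.
move=> mphi [M phiM].
have Lphi g : measurable_fun [set: R] g -> (forall x, `|phi (g x)| <= M) ->
    L1 (fun x => phi (g x)).
  by move=> mg gM; apply: L1_of_bounded; [exact: (measurableT_comp mphi mg)|exists M].
have avg2 g : measurable_fun [set: R] g -> (forall x, g (x + 1) = g x) ->
    (forall x, `|phi (g x)| <= M) ->
    2 * avg (fun x => phi (g x)) = avg (fun x => phi (g x) + phi (g (refl x))).
  move=> mg gP gM.
  have mpg : measurable_fun [set: R] (phi \o g) by exact: measurableT_comp.
  rewrite avgD; [|exact: Lphi|].
    by rewrite (@avg_reflect _ _ (phi \o g))//; [ring|move=> x /=; rewrite gP].
  by apply: (@L1_reflect _ _ (phi \o g))=> //; [move=> x /=; rewrite gP|exact: Lphi].
have fM x : `|phi (f x)| <= M by case: (f_swap x) => -[-> _].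
have : 2 * avg (fun x => phi (f x)) = 2 * avg (fun x => phi (r x)).
  rewrite !avg2//; apply: eq_avg => x _.
  by case: (f_swap x) => -[-> ->]//; exact: addrC.
by move=> /mulfI; apply.
Qed.

Let f_adm : admissible f.
Proof.
have [M rM] := r_bnd; apply: (@bounded_admissible _ _ M).
- exact: measurable_funTS.
- by move=> x _; case: (f_swap x) => -[-> _]; rewrite rM ltW.
- rewrite (equimeasurable (phi := id))//; first exact: admissible_mass r_adm.
  by exists M => x; rewrite gtr0_norm.
Qed.

Let entropy_f : avg (fun x => xlogx (f x)) = avg (fun x => xlogx (r x)).
Proof.
apply: (equimeasurable (phi := xlogx)).
  by apply: measurable_funM => //; exact: measurable_ln.
have [M rM] := r_bnd; exists (M ^+ 2 + 1) => x.
by apply: xlogx_bounded; rewrite rM ltW.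
Qed.

Let conv_D x : conv K D x = conv K r x - conv K r (refl x).
Proof.
have Lrr : L1 (fun x => r (refl x)) by exact: L1_reflect.
by rewrite convB// conv_reflect.
Qed.

Let conv_D_P x : conv K D x = conv K P x - conv K N x.
Proof. by rewrite -convB//; apply: eq_avg => y _; rewrite /P addrK. Qed.

(** Polarising changes the energy by that between the negative and the positive part
    of [D] across the axis, which minimality therefore makes nonpositive. *)
Let energy_N_P : energy K N P <= 0.
Proof.
have LNV h : L1 h -> L1 (fun x => N x * conv K h x) by exact: L1_energy.
have twice : 2 * energy K N r = energy K N P - energy K N N.
  have mNV : measurable_fun [set: R] (fun x => N x * conv K r x).
    by apply: measurable_funM => //; exact: conv_measurable.
  have NVP x : N (x + 1) * conv K r (x + 1) = N x * conv K r x.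
    by rewrite N_per conv_periodic.
  transitivity (avg (fun x => N x * conv K r x) +
      avg (fun x => N (refl x) * conv K r (refl x))).
    by rewrite (avg_reflect _ mNV NVP) /energy; ring.
  rewrite -avgD//; [|exact: LNV|]; last first.
    by apply: (L1_reflect _ mNV NVP); exact: LNV.
  rewrite -avgB; [|exact: LNV..].
  apply: eq_avg => x _; rewrite N_odd -mulrBr -conv_D_P conv_D; ring.
have fE : energy K f f = energy K r r + energy K N P.
  have -> : energy K f f = energy K (fun x => r x + 1 * N x) (fun x => r x + 1 * N x).
    by rewrite (_ : (fun x => _) = f)//; apply/funext => x; rewrite mul1r.
  by rewrite energy_line// mulr1 twice expr1n; ring.
have := r_min f_adm; rewrite /free_functional entropy_f fE; lra.
Qed.

Let N_cont x : c < x < c + 2^-1 -> {for x, continuous N}.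
Proof.
move=> xc; have near_xc : \forall y \near x, c < y < c + 2^-1.
  have /andP[x0 x1] := xc.
  near=> y; apply/andP; split; near: y; [exact: lt_nbhsr|exact: lt_nbhsl].
rewrite /prop_for /continuous_at (N_half xc).
have : (fun y => Num.max (- D y) 0) @ x --> Num.max (- D x) 0.
  apply: (@continuous_max _ _ (fun y => - D y) (cst 0)); last exact: cvg_cst.
  by apply: cvgN; exact: D_cont.
apply: cvg_trans; apply: near_eq_cvg.
by apply: filterS near_xc => y yc; rewrite N_half.
Unshelve. all: by end_near. Qed.

Let conv_P_eq0 x : c < x < c + 2^-1 -> D x < 0 -> conv K P x = 0.
Proof.
move=> xc Dx0.
have hKP := half_odd_conv mP LP hP.
have : N x * conv K P x = 0.
  apply: (@avg_le0_eq0 _ (fun x => N x * conv K P x)).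
  - exact: L1_energy.
  - by move=> y; exact: half_odd_mul_ge0 hN hKP.
  - by move=> y; rewrite N_per conv_periodic.
  - exact: energy_N_P.
  - by apply: cvgM; [exact: N_cont|exact: conv_continuous].
move=> /eqP; rewrite mulf_eq0 => /orP[|/eqP//].
by rewrite N_half// gt_eqF// lt_max oppr_gt0 Dx0.
Qed.

Let D_closed x0 : c < x0 < c + 2^-1 ->
  closure [set x | c < x < c + 2^-1 /\ D x < 0] x0 -> D x0 < 0.
Proof.
move=> xc cl.
have KP0 : conv K P x0 = 0.
  have : closed [set x | conv K P x = 0].
    have -> : [set x | conv K P x = 0] = conv K P @^-1` [set 0] by [].
    apply: preimage_closed; last exact: closed_eq.
    by move=> x _; exact: conv_continuous.
  apply; move: x0 cl {xc}; apply: closure_subset => x [xc Dx].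
  exact: conv_P_eq0.
have /andP[xc0 xc1] := xc.
have K0 : 0 < K (x0 - x0) - K (x0 - (2 * c - x0)).
  rewrite subrr subr_gt0; apply: K_max.
  rewrite (_ : x0 - (2 * c - x0) = (x0 - c) + (x0 - c)); last by ring.
  have [h|h] := leP (x0 - c + (x0 - c)) 2^-1.
    by rewrite cdist_id ger0_norm; lra.
  by rewrite -cdist1B cdist_id ger0_norm; lra.
have cK : continuous (fun y => K (x0 - y) - K (x0 - (2 * c - y))).
  have cont_aff a b : continuous (fun y => K (a + b * y)).
    move=> z; apply: (@continuous_comp _ _ _ (fun y => a + b * y) K).
      apply: cvgD; first exact: cvg_cst.
      by apply: cvgM; [exact: cvg_cst|exact: cvg_id].
    exact: kernel_continuous.
  rewrite (_ : (fun y => _) = (fun y => K (x0 + (- 1) * y) - K ((x0 - 2 * c) + 1 * y))).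
    by move=> z; apply: cvgB; exact: cont_aff.
  by apply/funext => y; congr (K _ - K _); ring.
have [e e0 He] := continuous_gt (cK x0) K0.
have [x1 [[x1c Dx1] x01]] := cl _ (nbhsx_ballx x0 e e0).
have KN : 0 < conv K N x0.
  apply: (@half_odd_conv_gt0 _ _ mN LN hN x0 x1) => //.
  - by rewrite -subr_gt0; apply: He.
  - exact: N_cont.
  - by rewrite N_half// lt_max oppr_gt0 Dx1.
rewrite /D subr_lt0 -ltr_ln ?posrE// !r_EL.
have := conv_D x0; rewrite conv_D_P KP0; lra.
Qed.

(** On the half circle, [{D < 0}] is open by continuity and closed by the
    Euler--Lagrange equation, hence all or nothing. *)
Lemma reflection_dichotomy x y : c < x < c + 2^-1 -> c < y < c + 2^-1 ->
  r x < r (2 * c - x) -> r y < r (2 * c - y).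
Proof.
move=> xc yc Dx.
pose A : set R := `]c, c + 2^-1[%classic.
pose B : set R := A `&` [set x | D x < 0].
have inA z : A z <-> c < z < c + 2^-1 by rewrite /A /= in_itv.
have AB : B = A.
  have cA : connected A by apply/connected_intervalP; exact: interval_is_interval.
  apply: cA.
  - by exists x; split; [exact/inA|rewrite /= /D subr_lt0].
  - exists [set x | D x < 0] => //.
    by apply: (open_comp _ (@open_lt R 0)) => z _; exact: D_cont.
  - exists (closure B); first exact: closed_closure.
    apply/seteqP; split=> z; first by move=> Bz; split; [case: Bz|exact: subset_closure].
    move=> [Az clz]; split=> //; apply: D_closed; first exact/inA.
    by apply: closure_subset clz => v [/inA].
have : B y by rewrite AB; exact/inA.
by case=> _ /=; rewrite /D subr_lt0.
Qed.

End Axis.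
End Kernel.
End Polarization.

(** * Functions that are ordered by every reflection *)

Section SymmetricDecreasing.
Context {R : realType}.
Implicit Types (x y c s t p : R).

Variable r : R -> R.
Hypotheses (r_cont : continuous r) (r_per : forall x, r (x + 1) = r x)
  (r_refl : forall c x y, c < x < c + 2^-1 -> c < y < c + 2^-1 ->
     r x < r (2 * c - x) -> r y < r (2 * c - y)).

Let periodic_max : exists p, forall x, r x <= r p.
Proof.
have [p _ pmax] : exists2 p, p \in `[0, 1] & forall x, x \in `[0, 1] -> r x <= r p.
  by apply: EVT_max => //; exact: continuous_subspaceT.
exists p => x; rewrite -(periodic_torus_repr x r_per); apply: pmax.
have := torus_repr_in x; rewrite /torus /= !in_itv /= => /andP[-> h].
exact: ltW.
Qed.

Lemma symmetric_decreasing_about_max :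
  exists p, forall x y, cdist (x - p) <= cdist (y - p) -> r y <= r x.
Proof.
have [p pmax] := periodic_max; exists p.
have half c y : c < p < c + 2^-1 -> c < y < c + 2^-1 -> r (2 * c - y) <= r y.
  move=> pc yc; rewrite leNgt; apply/negP => /(r_refl yc pc).
  by rewrite ltNge pmax.
have lt_case s t : `|s| < `|t| -> `|t| <= 2^-1 -> r (p + t) <= r (p + s).
  move=> st; rewrite ler_norml => /andP[t0 t1].
  have [tp|tn] := leP 0 t.
    rewrite (ger0_norm tp) ltr_norml in st; have /andP[s0 s1] := st.
    (* the axis through the midpoint of p + s and p + t, entered from its antipode *)
    have := half (p + (s + t) / 2 - 2^-1) (p + s).
    have -> : 2 * (p + (s + t) / 2 - 2^-1) - (p + s) = p + t + (- 1)%:~R.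
      by rewrite mulrNz mulr1z; lra.
    by rewrite periodic_int//; apply; apply/andP; split; lra.
  rewrite (ltr0_norm tn) ltr_norml in st; have /andP[s0 s1] := st.
  have := half (p + (s + t) / 2) (p + s).
  have -> : 2 * (p + (s + t) / 2) - (p + s) = p + t by lra.
  by apply; apply/andP; split; lra.
have le_case s t : `|s| <= `|t| -> `|t| <= 2^-1 -> r (p + t) <= r (p + s).
  move=> st t2; have [{}st|ts] := ltP `|s| `|t|; first exact: lt_case.
  have [t0|tN0] := eqVneq t 0.
    by move: st; rewrite t0 normr0 normr_le0 => /eqP ->.
  have s_gt0 : 0 < `|s| by rewrite (lt_le_trans _ ts)// normr_gt0.
  rewrite leNgt; apply/negP => rst.
  have cN : {for (p + s), continuous (fun x => - r x)}.
    by apply: cvgN; exact: r_cont.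
  have [|e e0 He] := continuous_gt (c := - r (p + t)) cN; first by rewrite ltrN2.
  pose a := Num.min 1 (e / (2 * `|s|)).
  have a0 : 0 < a by rewrite lt_min ltr01 divr_gt0// mulr_gt0.
  have a1 : a <= 1 by rewrite ge_min lexx.
  have ae : a * `|s| < e.
    apply: (@le_lt_trans _ _ (e / (2 * `|s|) * `|s|)).
      by rewrite ler_wpM2r// ge_min lexx orbT.
    by rewrite invfM mulrA divfK ?gt_eqF//; lra.
  have := He (p + (1 - a) * s).
  rewrite (_ : p + s - _ = a * s); last by ring.
  rewrite normrM gtr0_norm// => /(_ ae); rewrite ltrN2 ltNge => /negP; apply.
  apply: lt_case => //; rewrite normrM ger0_norm ?subr_ge0//.
  rewrite (lt_le_trans _ st)// mulrBl mul1r ltrBlDr ltrDl; exact: mulr_gt0.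
move=> x y; rewrite /cdist => xy.
have red z : r z = r (p + centered (z - p)).
  have [m ->] := centered_shift (z - p).
  by rewrite -(periodic_int z m r_per); congr r; ring.
rewrite (red x) (red y); apply: le_case => //; exact: cdist_le_half.
Qed.

End SymmetricDecreasing.

(** * The rescaled potential *)

Section PotentialKernel.
Context {R : realType}.
Variables (w : R -> R) (sw : R).
Hypothesis wA : assumptionA w sw.

(** A monotone even function that takes its minimum at a point other than 0 is
    constant near 0, which contradicts the positive second derivative. *)
Lemma potential_strict_min z : 0 < z -> w 0 < w z.
Proof.
move=> z0; rewrite lt_neqAle (A_min0 wA) andbT; apply/eqP => w0z.
have wcst x : `|x| < z -> w x = w 0.
  have pos y : 0 <= y -> y < z -> w y = w 0.
    move=> y0 yz; apply/le_anti; rewrite (A_min0 wA) andbT w0z.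
    by apply: (A_nondecreasing wA); rewrite ?in_itv/= ?andbT// ltW.
  case: (leP 0 x) => x0.
    by rewrite (ger0_norm x0); exact: pos.
  by rewrite (ltr0_norm x0) -(A_even wA) => xz; apply: pos => //; lra.
have near0 (x : R) : `|x| < z -> \forall y \near x, `|y : R| < z.
  rewrite ltr_norml => xz; have xI : x \in `]- z, z[ by rewrite in_itv.
  by apply: filterS (near_in_itvoo xI) => y; rewrite in_itv /= -ltr_norml.
have w'0 x : `|x| < z -> w^`()%classic x = 0.
  move=> xz; rewrite derive1E (@near_eq_derive _ _ _ w (cst (w 0))) ?derive_cst//.
  by apply: filterS (near0 _ xz) => y /wcst.
have : (w^`(2)%classic) 0 = 0.
  rewrite derive1nS derive1n1 derive1E.
  rewrite (@near_eq_derive _ _ _ (w^`()%classic) (cst 0)) ?derive_cst//.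
  by apply: filterS (near0 0 _) => [y /w'0//|]; rewrite normr0.
by have := A_convex0 wA => /[swap] ->; rewrite ltxx.
Qed.

Lemma potential_lipschitz : exists2 L, 0 <= L & forall x y, `|w x - w y| <= L * `|x - y|.
Proof.
have [M [_ HM]] := A_lipschitz wA.
exists (`|M| + 1); first by rewrite addr_ge0.
move=> x y; have := HM (`|M| + 1); rewrite ltr_pwDr ?ler_norm// => /(_ isT).
exact: (fun H => H (x, y) (conj I I)).
Qed.

(** By evenness the potential is a function of the distance to 0 on the circle, which
    makes it continuous across the cut at 1/2. *)
Lemma potentialE g l x : 0 < l -> potential w g l x = g * l * w (cdist x / l).
Proof.
move=> l0; rewrite /potential /cdist; congr (_ * _).
case: (leP 0 (centered x)) => c0; first by rewrite ger0_norm.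
by rewrite ltr0_norm// mulNr (A_even wA).
Qed.

Section Scale.
Variables g l : R.
Hypotheses (g0 : 0 < g) (l0 : 0 < l).

Lemma potential_is_kernel : is_kernel (potential w g l).
Proof.
split.
- have [L L0 wL] := potential_lipschitz; exists (g * l * L / l) => x y.
  rewrite !potentialE// -mulrBr normrM gtr0_norm ?mulr_gt0// -!mulrA.
  rewrite !ler_pM2l// (le_trans (wL _ _))// ler_wpM2l//.
  rewrite -mulrBl normrM (gtr0_norm (x := l^-1)) ?invr_gt0// mulrC.
  rewrite ler_pM2l ?invr_gt0// ler_norml.
  have := cdist_lipschitz x y; have := cdist_lipschitz y x.
  by rewrite (distrC y); move=> *; apply/andP; split; lra.
- by move=> x; rewrite !potentialE// cdistN.
- by move=> x; rewrite !potentialE// cdistD1.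
Qed.

Let K x : R := - potential w g l x.

Lemma attraction_is_kernel : is_kernel K.
Proof.
have [[L HL] even per] := potential_is_kernel; split.
- by exists L => x y; rewrite /K -opprD normrN; exact: HL.
- by move=> x; rewrite /K even.
- by move=> x; rewrite /K per.
Qed.

Lemma attraction_dec x y : cdist x <= cdist y -> K y <= K x.
Proof.
move=> xy; rewrite /K lerN2 !potentialE// ler_pM2l ?mulr_gt0//.
have pos z : cdist z / l \in `[0, +oo[.
  by rewrite in_itv/= andbT divr_ge0 ?normr_ge0 ?ltW.
by apply: (A_nondecreasing wA) => //; rewrite ler_pM2r ?invr_gt0.
Qed.

Lemma attraction_max x : 0 < cdist x -> K x < K 0.
Proof.
move=> x0; rewrite /K ltrN2 !potentialE// ltr_pM2l ?mulr_gt0//.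
have -> : cdist 0 / l = 0 by rewrite cdist_id normr0 ?mul0r// invr_ge0.
by apply: potential_strict_min; rewrite divr_gt0.
Qed.

End Scale.
End PotentialKernel.

(** * Probability measures on the torus given by a density *)

Section DensityMeasure.
Context {R : realType}.

Local Notation leb := (@lebesgue_measure R).
Local Notation torus := (@torus R).
Local Notation mR := (measurableTypeR R).

Lemma measurableI_torus (A : set mR) : measurable A -> measurable (A `&` torus : set mR).
Proof. by move=> mA; apply: measurableI => //; exact: measurable_torus. Qed.

(** The hypotheses are arguments of the measure so that its structure of
    probability measure can be inferred from the term. *)
Definition density_measure (f : R -> R) (mf : measurable_fun torus f)
    (f0 : forall x, torus x -> 0 <= f x)
    (f1 : (\int[leb]_(x in torus) (f x)%:E = 1)%E) (A : set mR) : \bar R :=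
  (\int[leb]_(x in A `&` torus) (f x)%:E)%E.

Variables (f : R -> R) (mf : measurable_fun torus f)
  (f0 : forall x, torus x -> 0 <= f x)
  (f1 : (\int[leb]_(x in torus) (f x)%:E = 1)%E).

Local Notation m := (density_measure mf f0 f1).

Let m0 : m set0 = 0%E.
Proof. by rewrite /density_measure set0I integral_set0. Qed.

Let m_ge0 A : (0 <= m A)%E.
Proof. by apply: integral_ge0 => x [_ Tx]; rewrite lee_fin f0. Qed.

Let m_sigma : semi_sigma_additive m.
Proof.
move=> F mF tF mUF; rewrite /density_measure setI_bigcupl ge0_integral_bigcup//=.
- apply: is_cvg_ereal_nneg_natsum => n _; exact: m_ge0.
- by move=> n; exact: measurableI_torus.
- apply: (measurable_funS measurable_torus); last exact/measurable_EFinP.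
  by move=> x [n _ []].
- by move=> x [n _ [_ Tx]]; rewrite lee_fin f0.
- apply/trivIsetP => i j _ _ ij; rewrite setIACA.
  by move/trivIsetP : tF => -> //; rewrite set0I.
Qed.

HB.instance Definition _ := isMeasure.Build _ _ _ m m0 m_ge0 m_sigma.

Let mT : m [set: mR] = 1%E.
Proof. by rewrite /density_measure setTI f1. Qed.

HB.instance Definition _ := Measure_isProbability.Build _ _ R m mT.

End DensityMeasure.

Section Densities.
Context {R : realType}.

Local Notation leb := (@lebesgue_measure R).
Local Notation torus := (@torus R).
Local Notation mR := (measurableTypeR R).
Local Notation prob := (probability (measurableTypeR R) R).
Implicit Types (mu nu : prob) (f h r : R -> R).

Lemma is_density_L1 mu f : prob_torus mu -> is_density mu f -> L1 f /\ avg f = 1.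
Proof.
move=> muT [mf f0 muf].
have If : (\int[leb]_(x in torus) (f x)%:E = 1)%E.
  by have := muf _ measurable_torus; rewrite setIid muT.
have Lf : L1 f.
  apply/integrableP; split; first exact/measurable_EFinP.
  rewrite (eq_integral (fun x : mR => (f x)%:E)) ?If ?ltry// => x /set_mem Tx /=.
  by rewrite ger0_norm// f0.
by split=> //; apply: EFin_inj; rewrite -avg_EFin.
Qed.

Lemma density_exists f : measurable_fun torus f ->
  (forall x, torus x -> 0 <= f x) -> L1 f -> avg f = 1 ->
  exists2 mu : prob, prob_torus mu & is_density mu f.
Proof.
move=> mf f0 Lf f1; have If : (\int[leb]_(x in torus) (f x)%:E = 1)%E.
  by rewrite avg_EFin// f1.
exists (density_measure mf f0 If); last by split.
by rewrite /prob_torus /= /density_measure setIid If.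
Qed.

(** This is what replaces the density of a minimiser by its continuous version. *)
Lemma is_density_ae mu f r : prob_torus mu -> is_density mu f ->
  measurable_fun torus r -> (forall x, torus x -> 0 <= r x) ->
  ae_eq leb torus f r -> is_density mu r.
Proof.
move=> muT df mr r0 fr; have [mf f0 muf] := df; split=> // A mA.
rewrite muf//; apply: ae_eq_integral.
- exact: measurableI_torus.
- by apply/measurable_EFinP; apply: measurable_funS mf => //; exact: measurable_torus.
- by apply/measurable_EFinP; apply: measurable_funS mr => //; exact: measurable_torus.
- by apply: filterS fr => x h [_ Tx]; rewrite h.
Qed.

Lemma is_density_unique mu f h : prob_torus mu -> is_density mu f ->
  is_density mu h -> ae_eq leb torus f h.
Proof.
move=> muT df dh; have [Lf _] := is_density_L1 muT df.
have [mf f0 muf] := df; have [mh h0 muh] := dh.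
have : ae_eq leb torus (EFin \o f) (EFin \o h).
  apply: integral_ae_eq => //; first exact: measurable_torus.
    exact/measurable_EFinP.
  move=> A AT mA; have AE : A `&` torus = A by exact/setIidPl.
  by have := muf _ mA; rewrite (muh _ mA) AE.
by apply: filterS => x H Tx; have [] := H Tx.
Qed.

Lemma same_prob_density mu nu f h : is_density mu f -> is_density nu h ->
  ae_eq leb torus f h -> same_prob mu nu.
Proof.
move=> [mf f0 muf] [mh h0 nuh] fh A mA; rewrite muf// nuh//.
apply: ae_eq_integral.
- exact: measurableI_torus.
- by apply/measurable_EFinP; apply: measurable_funS mf => //; exact: measurable_torus.
- by apply/measurable_EFinP; apply: measurable_funS mh => //; exact: measurable_torus.
- by apply: filterS fh => x H [_ Tx]; rewrite H.
Qed.

Lemma same_prob_is_density mu nu f :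
  same_prob mu nu -> is_density nu f -> is_density mu f.
Proof. by move=> mn [mf f0 nuf]; split=> // A mA; rewrite mn// nuf. Qed.

(** The uniform law lives on [`[0, 1]], the torus is [`[0, 1[]; the endpoint is
    negligible. *)
Lemma rho_unif_density : is_density (@rho_unif R) (cst 1).
Proof.
split=> // A mA; rewrite /rho_unif /= /uniform_prob integral_uniform_pdf.
transitivity (\int[leb]_(x in A `&` `[0%R, 1%R]) (cst 1%:E x))%E.
  apply: eq_integral => x; rewrite inE => -[_ /=]; rewrite in_itv /= => x01.
  by rewrite /uniform_pdf x01 subr0 invr1.
have mA0 : measurable (A `&` `[0, 1]%classic : set mR).
  by apply: measurableI => //; exact: measurable_itv.
have mAT := measurableI_torus mA.
rewrite !integral_cst// !mul1e; apply/eqP; rewrite eq_le; apply/andP; split; last first.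
  apply: le_measure; rewrite ?inE//.
  apply: setIS => x; rewrite /torus /= !in_itv /= => /andP[-> h]; exact: ltW.
rewrite -[X in (_ <= X)%E]adde0 -(@lebesgue_measure_set1 R 1).
apply: (le_trans _ (measureU2 _ _ _)) => //.
apply: le_measure; rewrite ?inE//; first exact: measurableU.
move=> x [Ax]; rewrite /= in_itv /= => /andP[x0].
rewrite le_eqVlt => /predU1P[->|x1]; [by right|left].
by split=> //; rewrite /torus /= in_itv /= x0.
Qed.

Lemma prob_torus_unif : prob_torus (@rho_unif R).
Proof.
have [_ _ /(_ _ measurable_torus) muT] := rho_unif_density.
apply: (eq_trans muT); rewrite setIid avg_EFin; last exact: L1_cst.
by rewrite avg_cst.
Qed.

End Densities.

(** * Minimisers *)

Section Minimisers.
Context {R : realType}.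

Local Notation leb := (@lebesgue_measure R).
Local Notation torus := (@torus R).
Local Notation mR := (measurableTypeR R).
Local Notation prob := (probability (measurableTypeR R) R).
Implicit Types (mu nu : prob) (f h r : R -> R).

Lemma conv_ae K f h x : is_kernel K -> L1 f -> measurable_fun torus h ->
  ae_eq leb torus f h -> conv K h x = conv K f x.
Proof.
move=> kK Lf mh fh; apply: (ae_eq_avg (L1_conv kK x Lf) _ _).2.
  apply: measurable_funM => //; apply: measurable_funTS.
  exact: measurable_shift_kernel.
by apply: filterS fh => y H Ty; rewrite H.
Qed.

Lemma free_ae K f h : is_kernel K -> L1 f -> L1 (fun x => xlogx (f x)) ->
  measurable_fun torus h -> ae_eq leb torus f h -> free_functional K h = free_functional K f.
Proof.
move=> kK Lf Lxf mh fh; have [Lh _] := ae_eq_avg Lf mh fh; congr (_ - _ * _).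
  apply: (ae_eq_avg Lxf (measurable_xlogx mh) _).2.
  by apply: filterS fh => y H Ty; rewrite H.
apply: (ae_eq_avg (L1_energy kK Lf Lf) _ _).2.
  by apply: L1_measurable; exact: L1_energy.
by apply: filterS (fh) => y H Ty; rewrite (conv_ae _ kK Lf mh fh) H.
Qed.

Section Potential.
Variables (w : R -> R) (sw l : R).
Hypotheses (wA : assumptionA w sw) (l0 : 0 < l).

Local Notation K g := (fun x => - potential w g l x).

Section Strength.
Variable g : R.
Hypothesis g0 : 0 < g.

Let kP := potential_is_kernel wA g0 l0.
Let kK := attraction_is_kernel wA g0 l0.

Lemma interactionE f : L1 f ->
  interaction w g l f = (- (2^-1 * energy (K g) f f))%:E.
Proof.
move=> Lf; rewrite /interaction.
have -> : (\int[leb \x leb]_(z in torus `*` torus)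
     (potential w g l (z.1 - z.2)%R * f z.1 * f z.2)%:E)%E =
     (energy (potential w g l) f f)%:E by exact: (energy_prod kP Lf Lf).
rewrite -EFinM; congr EFin; rewrite -mulrN; congr (_ * _).
rewrite /energy -avgN; last exact: (L1_energy kK).
apply: eq_avg => x _; rewrite -mulrN; congr (_ * _).
rewrite /conv -avgN; last exact: (L1_conv kK).
by apply: eq_avg => y _; rewrite mulNr opprK.
Qed.

(** The definition evaluates the functional at a density picked by choice; by almost
    everywhere uniqueness any density of finite entropy gives the same value. *)
Lemma free_energyE mu f : prob_torus mu -> is_density mu f ->
  L1 (fun x => xlogx (f x)) -> free_energy w g l mu = (free_functional (K g) f)%:E.
Proof.
move=> muT df Lxf; have [Lf f1] := is_density_L1 muT df.
have dd : is_density mu (density mu) by exact: (xgetPex (cst 0) (ex_intro _ f df)).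
have fd := is_density_unique muT df dd.
have [Ld _] := is_density_L1 muT dd.
have [md _ _] := dd.
have [Lxd _] : L1 (fun x => xlogx (density mu x)) /\
    avg (fun x => xlogx (density mu x)) = avg (fun x => xlogx (f x)).
  apply: ae_eq_avg => //; first exact: measurable_xlogx.
  by apply: filterS fd => y H Ty; rewrite H.
rewrite /free_energy asboolT; last by split=> //; exists f.
rewrite interactionE// /entropy avg_EFin// -EFinD; congr EFin.
by rewrite -(free_ae kK Lf Lxf md fd).
Qed.

Lemma minimiser_free mu f : minimiser w g l mu -> is_density mu f -> admissible f ->
  forall h, admissible h -> free_functional (K g) f <= free_functional (K g) h.
Proof.
move=> [muT mumin] df [_ Lf _ Lxf] h [h0 Lh h1 Lxh].
have [nu nuT dh] := density_exists (L1_measurable Lh) h0 Lh h1.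
have := mumin nu nuT.
by rewrite (free_energyE muT df Lxf) (free_energyE nuT dh Lxh) lee_fin.
Qed.

(** The uniform state has finite free energy, hence so has a minimiser. *)
Lemma minimiser_density mu : minimiser w g l mu ->
  exists2 f, is_density mu f & admissible f.
Proof.
move=> [muT mumin].
have : (free_energy w g l mu < +oo)%E.
  apply: le_lt_trans (mumin _ prob_torus_unif) _.
  rewrite (free_energyE prob_torus_unif rho_unif_density) ?ltry//.
  exact: admissible_entropy admissible_cst1.
rewrite /free_energy; case: asboolP => // -[[f df] Lx] _.
have dd : is_density mu (density mu) by exact: (xgetPex (cst 0) (ex_intro _ f df)).
have [Ld d1] := is_density_L1 muT dd; have [_ d0 _] := dd.
by exists (density mu).
Qed.

(** The continuous version of the density is symmetric decreasing about some [p], and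
    its rearrangement is its translate by [p]. *)
Lemma minimiser_single_cluster mu : minimiser w g l mu -> single_cluster mu.
Proof.
move=> mumin; have muT := mumin.1.
have [f df af] := minimiser_density mumin; have Lf := admissible_L1 af.
pose r := gibbs_density (K g) f.
have fr : ae_eq leb torus f r.
  by apply: (euler_lagrange kK Lf af); exact: (minimiser_free mumin df af).
have r_gt0 x : 0 < r x by exact: (gibbs_density_gt0 kK Lf).
have r_cont : continuous r by exact: (gibbs_density_continuous kK Lf).
have r_per x : r (x + 1) = r x by exact: (gibbs_density_periodic f kK).
have mr : measurable_fun [set: R] r by exact: continuous_measurable_fun.
have dr : is_density mu r.
  apply: (is_density_ae muT df) => //; first exact: measurable_funTS.
  by move=> x _; exact: ltW.
have ar : admissible r by exact: (gibbs_density_admissible kK Lf).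
have r_EL x : ln (r x) = conv (K g) r x - ln (avg (fun x => expR (conv (K g) f x))).
  rewrite ln_gibbs_density// (conv_ae x kK Lf _ fr)//.
  exact: measurable_funTS.
have r_min := minimiser_free mumin dr ar.
have r_bnd : exists M, forall x, r x <= M by exact: (gibbs_density_bounded kK Lf).
have [p rp] := symmetric_decreasing_about_max r_cont r_per
  (reflection_dichotomy kK (attraction_dec wA g0 l0) (attraction_max wA g0 l0)
     r_cont r_per r_gt0 ar r_bnd r_min r_EL).
exists r, (fun x => r (x + p)), (- p); split; [exact: dr| |]; last first.
  apply: aeW => x _; rewrite /translation.
  have [m ->] := torus_repr_shift (x - p).
  by rewrite addrAC subrK periodic_int.
have mrp : measurable_fun [set: R] (fun x => r (x + p)).
  by apply: (measurableT_comp mr); exact: measurable_funD.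
split.
- exact: measurable_funTS.
- by move=> x _; exact: ltW.
- move=> x y _ _; rewrite /torus_dist !subr0 => xy; apply: rp.
  by rewrite !addrK.
- move=> t t0; apply: (@lebesgue_torus_shift _ p [set x | t < r x]).
    rewrite -[X in measurable X]setTI.
    have -> : [set x | t < r x] = r @^-1` `]t, +oo[.
      by apply/seteqP; split=> x /=; rewrite in_itv/= andbT.
    by apply: mr => //; exact: measurable_itv.
  by move=> x; rewrite /= r_per.
Qed.

End Strength.

Lemma energy_strength g f : 0 < g -> L1 f ->
  energy (K g) f f = g * energy (K 1) f f.
Proof.
move=> g0 Lf; have kK := attraction_is_kernel wA ltr01 l0.
rewrite /energy -avgZ; last exact: (L1_energy kK).
apply: eq_avg => x _; rewrite mulrCA; congr (_ * _).
rewrite /conv -avgZ; last exact: (L1_conv kK).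
by apply: eq_avg => y _; rewrite /potential mul1r; ring.
Qed.

(** Beyond the transition point some density has positive entropy but an
    interaction energy that already compensates for it at a smaller strength;
    its advantage over the uniform state grows linearly with the strength. *)
Lemma minimiser_not_unif gc g mu : transition_point w l gc -> gc < g ->
  minimiser w g l mu -> ~ same_prob mu (@rho_unif R).
Proof.
move=> [gc0 _ _ above] gcg mumin mu_unif.
have g0 : 0 < g by exact: lt_trans gcg.
pose g1 := (gc + g) / 2.
have [gcg1 g1g] : gc < g1 /\ g1 < g by rewrite /g1; split; lra.
have g10 : 0 < g1 by exact: lt_trans gcg1.
have [nu numin nuN] := above _ gcg1.
have [f df af] := minimiser_density g10 numin.
have a1 := @admissible_cst1 R.
have d1 := same_prob_is_density mu_unif rho_unif_density.
have ent : 0 < avg (fun x => xlogx (f x)).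
  apply: entropy_gt0 => // f1; apply: nuN.
  exact: same_prob_density df rho_unif_density f1.
have := minimiser_free g10 numin df af a1.
have := minimiser_free g0 mumin d1 a1 af.
have [Lf L1] := (admissible_L1 af, admissible_L1 a1).
rewrite /free_functional !entropy_cst1 (energy_strength g10 Lf) (energy_strength g10 L1).
rewrite (energy_strength g0 Lf) (energy_strength g0 L1).
set A := avg _ in ent *; set e1 := energy _ _ _; set e2 := energy _ _ _.
move=> h1 h2.
have h3 : A <= g1 * (2^-1 * (e2 - e1)) by lra.
have h4 : g * (2^-1 * (e2 - e1)) <= A by lra.
have e12 : 0 < 2^-1 * (e2 - e1) by rewrite -(pmulr_rgt0 _ g10) (lt_le_trans ent).
have : g * (2^-1 * (e2 - e1)) <= g1 * (2^-1 * (e2 - e1)) by exact: le_trans h3.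
by rewrite ler_pM2r// leNgt g1g.
Qed.

End Potential.
End Minimisers.

Unset Implicit Arguments.

Theorem corollary3p5 (R : realType) (w : R -> R) (sw : R) :
  assumptionA w sw ->
  C2_on `]- sw, sw[%classic w ->
  \forall l \near (0 : R)^'+,
    forall gc : R, transition_point w l gc ->
    forall g : R, gc < g ->
      (exists mu : probability (measurableTypeR R) R, minimiser w g l mu) /\
      (forall mu : probability (measurableTypeR R) R, minimiser w g l mu ->
         ~ same_prob mu rho_unif /\ single_cluster mu).
Proof.
move=> wA _; near=> l.
have l0 : 0 < l by near: l; exact: nbhs_right_gt.
move=> gc tr g gcg; have [gc0 _ _ above] := tr.
have g0 : 0 < g by exact: lt_trans gcg.
split; first by have [mu mumin _] := above _ gcg; exists mu.
move=> mu mumin; split; first exact: (minimiser_not_unif wA l0 tr gcg mumin).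
exact: (minimiser_single_cluster wA l0 g0 mumin).
Unshelve. all: by end_near. Qed.
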